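(* $p_{\mathrm{max}}(\mathbb{Z}^2)\ge \tfrac{1}{32}\left(35-3\sqrt{33}\right)$ (which equals $0.555197\dots$).
   Context: $\mathbb{Z}^2$ denotes the lattice graph: its vertices are the points with integer coordinates, and two vertices are adjacent iff they are at Euclidean distance $1$. A bond percolation model on a (possibly infinite) graph $G$ is a probability distribution on the spanning subgraphs of $G$; an edge is open if it is present in the random subgraph and closed otherwise. The model is 1-independent if, for any two disjoint sets of edges $S_1$, $S_2$ of $G$ such that no edge in $S_1$ shares a vertex with an edge in $S_2$, the states (open or closed) of the edges in $S_1$ are independent of the states of the edges in $S_2$. A model on an infinite graph percolates if the random subgraph has an infinite component with positive probability. $\mathcal{D}_{\ge p}(G)$ is the class of 1-independent bond percolation models on $G$ in which each edge is open with probability at least $p$, and $$p_{\mathrm{max}}(G)=\sup\{p : \text{some model in } \mathcal{D}_{\ge p}(G) \text{ does not percolate}\}.$$ *)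

(* Defs.v *)
From mathcomp Require Import all_boot all_order all_algebra.
From mathcomp Require Import all_classical all_reals all_analysis.

Set Implicit Arguments.
Unset Strict Implicit.
Unset Printing Implicit Defensive.

Import Order.TTheory GRing.Theory Num.Theory.

Local Open Scope classical_set_scope.
Local Open Scope ring_scope.

(* Vertices form a countType: this makes the event that there is an infinite
   component measurable, so that its probability below is meaningful. *)
Record graph := Graph {
  vertex :> countType;
  adj : rel vertex;
  adj_sym : symmetric adj;
  adj_irr : irreflexive adj }.

Definition edge (G : graph) :=
  {e : set G | exists x y : G, adj x y /\ e = [set x; y]}.

Definition share_vertex (G : graph) (e f : edge G) :=
  exists x : G, sval e x /\ sval f x.

(* A spanning subgraph is identified with its set of (open) edges. *)
Definition spanning_subgraph (G : graph) := set (edge G).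

Definition is_open (G : graph) (e : edge G) : set (spanning_subgraph G) :=
  [set w | w e].

Definition edge_events (G : graph) (S : set (edge G)) :
  set (set (spanning_subgraph G)) := [set is_open e | e in S].

(* The sigma-algebra generated by the states of the edges in S. *)
Definition sigma_edges (G : graph) (S : set (edge G)) :
  set (set (spanning_subgraph G)) := <<s edge_events S >>.

Definition percolation_space (G : graph) :=
  g_sigma_algebraType (edge_events [set: edge G]).

Definition percolation_model (R : realType) (G : graph) :=
  probability (percolation_space G) R.

Definition one_independent (R : realType) (G : graph)
    (mu : percolation_model R G) :=
  forall S1 S2 : set (edge G),
    S1 `&` S2 = set0 ->
    (forall e f, S1 e -> S2 f -> ~ share_vertex e f) ->
    forall A B, sigma_edges S1 A -> sigma_edges S2 B ->
      mu (A `&` B) = (mu A * mu B)%E.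

Definition open_adj (G : graph) (w : spanning_subgraph G) : rel G :=
  fun x y => `[< exists e : edge G, w e /\ sval e = [set x; y] >].

Definition component (G : graph) (w : spanning_subgraph G) (x : G) : set G :=
  [set y | exists p : seq G, path (open_adj w) x p /\ last x p = y].

Definition has_infinite_component (G : graph) : set (spanning_subgraph G) :=
  [set w | exists x : G, infinite_set (component w x)].

Definition percolates (R : realType) (G : graph)
    (mu : percolation_model R G) :=
  (0 < mu (@has_infinite_component G))%E.

Definition D_ge (R : realType) (G : graph) (p : R) :
  set (percolation_model R G) :=
  [set mu | one_independent mu /\
            forall e : edge G, (p%:E <= mu (is_open e))%E].

(* If G has an edge, the set is bounded above by 1; it contains 0 because the
   model in which all edges are closed does not percolate.  Hence sup is a true
   supremum, not the default value 0. *)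
Definition p_max (R : realType) (G : graph) : R :=
  sup [set p : R | exists mu : percolation_model R G,
                     D_ge p mu /\ ~ percolates mu].

Definition euclidean_dist (R : realType) (x y : int * int) : R :=
  Num.sqrt ((x.1%:~R - y.1%:~R) ^+ 2 + (x.2%:~R - y.2%:~R) ^+ 2).

Definition Z2_adj (R : realType) : rel (int * int) :=
  fun x y => euclidean_dist R x y == 1.

Lemma Z2_adj_sym (R : realType) : symmetric (Z2_adj R).
Proof.
move=> x y; rewrite /Z2_adj /euclidean_dist.
by rewrite -sqrrN opprB -[in X in _ + X]sqrrN opprB.
Qed.

Lemma Z2_adj_irr (R : realType) : irreflexive (Z2_adj R).
Proof.
move=> x; rewrite /Z2_adj /euclidean_dist !subrr expr0n addr0 sqrtr0.
by rewrite eq_sym oner_eq0.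
Qed.

Definition Z2 (R : realType) : graph :=
  Graph (@Z2_adj_sym R) (@Z2_adj_irr R).

(* Main.v *)
(* Let q0 = (sqrt 33 - 1) / 8, so that q0^2 + (1 - q0)/2 = 1 - 3 q0/4 = (35 - 3 sqrt 33)/32.
   Colour the sites black with probability q, independently, for a rational q slightly below q0.

   Either black nearest-neighbour crossings or white star-crossings of annuli are blockable:
   outside every box there is an annulus that is not crossed with probability at least eps.
   Otherwise all large annuli around a box are crossed, with probability almost 1, in both ways;
   the square root trick then gives, with positive probability, six arms of alternating colours
   from one box to prescribed boundary arcs.  When the box is recoloured black it becomes a cut
   set with three branches, and these are too many by the counting argument of Burton and Keane.

   In a leaf model every site is solid or a leaf, and a leaf chooses one neighbour; an edge is
   open if both its ends are solid or if one end is a leaf that has chosen the other one.  A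
   simple open path between two solid sites has only solid sites.  If black crossings are
   blockable, let the solid sites be the black ones and those of sparse diamonds |x| + |y| = r,
   and let leaves choose the right or the upper neighbour: edges are open with probability
   q^2 + (1 - q)/2, or at least q at a diamond.  If white star-crossings are blockable, let the
   odd sites and the white even sites be solid, and let leaves choose one of four neighbours:
   edges are open with probability 1 - 3 q/4.  In both cases an infinite component would cross all
   but finitely many of a sequence of disjoint annuli. *)

Require Import Defs.
From HB Require Import structures.
From mathcomp Require Import all_boot all_order all_algebra.
From mathcomp Require Import ring lra zify.
From mathcomp Require Import all_classical all_reals all_analysis.

Set Implicit Arguments.
Unset Strict Implicit.
Unset Printing Implicit Defensive.

Import Order.TTheory GRing.Theory Num.Theory.
Import numFieldNormedType.Exports.

Local Open Scope classical_set_scope.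
Local Open Scope ring_scope.

(** * Finite product measures *)

(** Which case of the dichotomy holds at a given [q] is never decided: that would mean locating the
    critical probability of site percolation. So the bound obtained is the smaller of the two edge
    probabilities q^2 + (1 - q)/2, increasing for q > 1/4, and 1 - 3 q/4, decreasing. The best
    choice makes them equal, q^2 + q/4 = 1/2, whose positive root is q0. [q] is rational because
    labels take 4 m equally likely values: the quotient by 4 gives the colour, the remainder the
    choice of a leaf. The obstacle in a leaf model is that leaves may form long chains, on which
    colours give no control. The diamonds, or the odd sublattice, are solid checkpoints that a long
    path must visit. Blocking with a fixed probability is enough because disjoint annuli are
    independent. The contradiction behind the dichotomy is volume against surface: K^2 disjoint
    boxes are cut sets with probability bounded below, yet a rim of length of order K bounds their
    number. It is drawn from an expectation over a finite box. *)

Section Expectation.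
Variables (R : realFieldType) (V : eqType) (St : finType) (law : St -> R).
Hypothesis law_ge0 : forall s, 0 <= law s.
Hypothesis law_sum1 : \sum_s law s = 1.
Implicit Types (S T : seq V) (w : V -> St) (f g : (V -> St) -> R).

Definition upd w (v : V) (s : St) : V -> St := fun u => if u == v then s else w u.

(* The coordinates in S are resampled independently; the others are those of w. *)
Fixpoint expect S f w : R :=
  if S is v :: S' then \sum_s law s * expect S' f (upd w v s) else f w.

Definition depends_on (A : Type) S (f : (V -> St) -> A) :=
  forall w w', {in S, w =1 w'} -> f w = f w'.

Lemma expect_ext S f g w : (forall w, f w = g w) -> expect S f w = expect S g w.
Proof.
move=> fg; elim: S w => [|v S IH] w /=; first exact: fg.
by apply: eq_bigr => s _; rewrite IH.
Qed.

Lemma expect_le S f g w : (forall w, f w <= g w) -> expect S f w <= expect S g w.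
Proof.
move=> fg; elim: S w => [|v S IH] w /=; first exact: fg.
by apply: ler_sum => s _; rewrite ler_wpM2l.
Qed.

Lemma expect_cst S c w : expect S (fun=> c) w = c.
Proof.
elim: S w => [//|v S IH] w /=.
by under eq_bigr do rewrite IH; rewrite -mulr_suml law_sum1 mul1r.
Qed.

Lemma expect_add S f g w :
  expect S (fun w => f w + g w) w = expect S f w + expect S g w.
Proof.
elim: S w => [//|v S IH] w /=.
by rewrite -big_split; apply: eq_bigr => s _; rewrite IH mulrDr.
Qed.

Lemma expect_mulr S f c w : expect S (fun w => f w * c) w = expect S f w * c.
Proof.
elim: S w => [//|v S IH] w /=.
by rewrite mulr_suml; apply: eq_bigr => s _; rewrite IH mulrA.
Qed.

Lemma expect_opp S f w : expect S (fun w => - f w) w = - expect S f w.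
Proof.
rewrite -mulrN1 -expect_mulr; apply: expect_ext => w'; by rewrite mulrN1.
Qed.

Lemma expect_sum (I : Type) (r : seq I) S (F : I -> (V -> St) -> R) w :
  expect S (fun w => \sum_(i <- r) F i w) w = \sum_(i <- r) expect S (F i) w.
Proof.
elim: r => [|i r IH]; last first.
  rewrite big_cons -IH -expect_add.
  by apply: expect_ext => w'; rewrite big_cons.
rewrite big_nil -{2}(expect_cst S 0 w).
by apply: expect_ext => w'; rewrite big_nil.
Qed.

Lemma expect_ge0 S f w : (forall w, 0 <= f w) -> 0 <= expect S f w.
Proof. by move=> f0; rewrite -(expect_cst S 0 w); exact: expect_le. Qed.

Lemma expect_cat S T f w : expect (S ++ T) f w = expect S (expect T f) w.
Proof.
elim: S w => [//|v S IH] w /=.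
by apply: eq_bigr => s _; rewrite IH.
Qed.

Lemma eq_expect S T f w w' :
  depends_on T f -> (forall v, v \in T -> v \notin S -> w v = w' v) ->
  expect S f w = expect S f w'.
Proof.
move=> df; elim: S w w' => [|v S IH] w w' ww' /=.
  by apply: df => v vT; exact: ww'.
apply: eq_bigr => s _; congr (_ * _); apply: IH => u uT uS.
rewrite /upd; case: eqP => // /eqP uv; apply: ww' => //.
by rewrite inE negb_or uv.
Qed.

Lemma expect_mul_indep S T f g w : depends_on T g -> {in S, forall v, v \notin T} ->
  expect S (fun w => f w * g w) w = expect S f w * g w.
Proof.
move=> dg; elim: S w => [//|v S IH] w ST /=.
rewrite mulr_suml; apply: eq_bigr => s _; rewrite IH.
  rewrite mulrA; congr (_ * _); apply: dg => u uT; rewrite /upd.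
  by case: eqP => // uv; have := ST v (mem_head _ _); rewrite -uv uT.
by move=> u uS; apply: ST; rewrite inE uS orbT.
Qed.

(** Resampling [T] leaves [f] alone, and the resulting expectation of [g] does not see the
    coordinates in [S]. *)
Lemma expect_indep S T f g w : depends_on S f -> depends_on T g ->
  {in S, forall v, v \notin T} ->
  expect (S ++ T) (fun w => f w * g w) w = expect S f w * expect T g w.
Proof.
move=> df dg ST; rewrite expect_cat.
transitivity (expect S (fun w' => f w' * expect T g w) w); last first.
  by rewrite expect_mulr.
have key : forall w', {in T, w =1 w'} -> expect T (fun w => f w * g w) w' = f w' * expect T g w.
  move=> w' ww'.
  under (@expect_ext T) do rewrite mulrC.
  rewrite (@expect_mul_indep T S) // => [|v vT]; last first.
    by apply/negP => /ST; rewrite vT.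
  rewrite mulrC; congr (_ * _); apply: (@eq_expect _ T) => // v vT.
  by rewrite vT.
(* The induction over [S] changes the base configuration; all that has to survive is its agreement
   with [w] on [T]. *)
suff gen w' : {in T, w =1 w'} -> expect S (expect T (fun w => f w * g w)) w' =
    expect S (fun w' => f w' * expect T g w) w' by exact: gen.
elim: S {df} ST w' => [|v S IH] ST w' ww' /=; first exact: key.
apply: eq_bigr => s _; congr (_ * _); apply: IH => [u uS|u uT].
  by apply: ST; rewrite inE uS orbT.
rewrite /upd; case: eqP => [uv|_]; last exact: ww'.
by have := ST v (mem_head _ _); rewrite -uv uT.
Qed.

Lemma updC w u v s t : u != v -> upd (upd w u s) v t = upd (upd w v t) u s.
Proof.
move=> uv; apply: funext => x; rewrite /upd.
by case: (eqVneq x v) => [->|//]; rewrite eq_sym (negbTE uv).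
Qed.

Lemma expect_swap S f u v w : expect (u :: v :: S) f w = expect (v :: u :: S) f w.
Proof.
have [->//|uv] := eqVneq u v; rewrite /=.
under eq_bigr do rewrite mulr_sumr.
rewrite exchange_big; apply: eq_bigr => t _.
rewrite mulr_sumr; apply: eq_bigr => s _.
by rewrite mulrCA (updC _ _ _ uv).
Qed.

Lemma expect_perm S T f w : perm_eq S T -> expect S f w = expect T f w.
Proof.
elim: S T w => [|v S IH] T w ST.
  by move: ST; rewrite perm_sym => /perm_nilP ->.
have /splitPr vT : v \in T by rewrite -(perm_mem ST) mem_head.
case: vT ST => T1 T2; rewrite -cat_rcons => ST.
have {}ST : perm_eq S (T1 ++ T2).
  rewrite -(perm_cons v) (permPl ST) cat_rcons.
  exact/permPl/(perm_catCA T1 [:: v] T2).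
rewrite cat_rcons {1}/expect -/expect.
transitivity (expect (v :: T1 ++ T2) f w).
  by rewrite /=; apply: eq_bigr => s _; rewrite (IH _ _ ST).
elim: T1 w {ST IH} => [//|u T1 IH] w.
rewrite !cat_cons expect_swap {1}/expect -/expect [RHS]/=.
by apply: eq_bigr => s _; rewrite -IH.
Qed.

Lemma expect_off S f w : {in S, forall v s w, f (upd w v s) = f w} -> expect S f w = f w.
Proof.
elim: S w => [//|v S IH] w fS /=.
rewrite (eq_bigr (fun s => law s * f w)) => [|s _].
  by rewrite -mulr_suml law_sum1 mul1r.
rewrite IH ?(fS v) ?mem_head // => u uS s' w'.
by apply: fS; rewrite inE uS orbT.
Qed.

(** The coordinates of [T] outside [S] are moved innermost, where they integrate to one. *)
Lemma expect_sub S T f w : uniq S -> uniq T -> {subset S <= T} -> depends_on S f ->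
  expect T f w = expect S f w.
Proof.
move=> uS uT ST df.
have /expect_perm -> : perm_eq T (S ++ [seq v <- T | v \notin S]).
  apply: uniq_perm => //.
    rewrite cat_uniq uS filter_uniq // andbT.
    by apply/hasPn => v; rewrite mem_filter => /andP[].
  move=> v; rewrite mem_cat mem_filter.
  by case: (boolP (v \in S)) => //= /ST.
rewrite expect_cat; apply: expect_ext => w'; apply: expect_off => v.
rewrite mem_filter => /andP[vS _] s w''; apply: df => u uS'.
by rewrite /upd; case: eqP => // uv; rewrite -uv uS' in vS.
Qed.

End Expectation.

Lemma expect_map (R : realFieldType) (V V' : eqType) (St : finType) (law : St -> R)
    (h : V -> V') (S : seq V) (F : (V -> St) -> R) w : injective h ->
  expect law (map h S) (fun w => F (w \o h)) w = expect law S F (w \o h).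
Proof.
move=> inj_h; elim: S w => [//|v S IH] w /=.
apply: eq_bigr => s _; rewrite IH; congr (_ * expect _ _ _ _).
by apply: funext => x; rewrite /upd /= (inj_eq inj_h).
Qed.

(** Change of variables. It serves to pass from labels to colours and to exchange black and
    white. *)
Lemma expect_push (R : realFieldType) (V : eqType) (St St' : finType)
    (law : St -> R) (law' : St' -> R) (h : St -> St') (S : seq V) (F : (V -> St') -> R) w :
  (forall t, law' t = \sum_(s | h s == t) law s) ->
  expect law S (fun w => F (h \o w)) w = expect law' S F (h \o w).
Proof.
move=> lawE; elim: S w => [//|v S IH] w /=.
under [RHS]eq_bigr do rewrite lawE mulr_suml.
rewrite (partition_big h xpredT) //=; apply: eq_bigr => t _.
apply: eq_bigr => s /eqP <-; rewrite IH; congr (_ * expect _ _ _ _).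
by apply: funext => x; rewrite /upd /=; case: eqP.
Qed.

(** * Harris' inequality for independent coins *)

Section Harris.
Variables (R : realFieldType) (V : eqType) (q : R).
Hypothesis q01 : 0 <= q <= 1.

Definition coin (b : bool) : R := if b then q else 1 - q.

Lemma coin_ge0 b : 0 <= coin b.
Proof. by have /andP[q0 q1] := q01; case: b => /=; lra. Qed.

Lemma coin_sum1 : \sum_b coin b = 1.
Proof. by rewrite big_bool /=; lra. Qed.

Definition increasing (f : (V -> bool) -> R) :=
  forall w w', (forall v, w v ==> w' v) -> f w <= f w'.

Lemma increasing_expect S f : increasing f -> increasing (expect coin S f).
Proof.
move=> incf; elim: S => [//|v S IH] w w' ww' /=.
apply: ler_sum => s _; apply: ler_wpM2l; first exact: coin_ge0.
by apply: IH => u; rewrite /upd; case: eqP => // _; exact: implybb.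
Qed.

(** Induction over the sites: the inductive hypothesis is used for each colour of [v], and
    Chebyshev's inequality then combines the two conditional expectations, both of which increase
    with the colour of [v]. *)
Lemma harris S f g w : increasing f -> increasing g ->
  expect coin S f w * expect coin S g w <= expect coin S (fun w => f w * g w) w.
Proof.
have /andP[q0 q1] := q01.
move=> incf incg; elim: S w => [//|v S IH] w /=; rewrite !big_bool /=.
have up b : forall u, upd w v false u ==> upd w v b u.
  by move=> u; rewrite /upd; case: eqP => //= _; case: (w u).
have := IH (upd w v true); have := IH (upd w v false).
have := increasing_expect S incf (up true).
have := increasing_expect S incg (up true).
set a := expect _ _ _ _; set b := expect _ _ _ _; set c := expect _ _ _ _.
set d := expect _ _ _ _; set x := expect _ _ _ _; set y := expect _ _ _ _.
move=> ab cd xcd yab.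
have h1 : (1 - q) * (c * a) <= (1 - q) * x by apply: ler_wpM2l => //; lra.
have h2 : q * (d * b) <= q * y by apply: ler_wpM2l => //; lra.
(* This is the covariance of the two conditional expectations as functions of the coin at [v]. *)
have h3 : 0 <= q * (1 - q) * ((b - a) * (d - c)).
  by rewrite !mulr_ge0 ?subr_ge0 //; lra.
have -> : (q * d + (1 - q) * c) * (q * b + (1 - q) * a) =
  (1 - q) * (c * a) + q * (d * b) - q * (1 - q) * ((b - a) * (d - c)) by ring.
lra.
Qed.

End Harris.

(** * The counting argument of Burton and Keane *)

Section Connection.
Variables (V : eqType) (e : rel V).
Hypothesis e_sym : symmetric e.
Implicit Types (P Q : pred V) (p : seq V).

Definition connected_in P x y :=
  exists p, [/\ path e x p, all P (x :: p) & last x p = y].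

Lemma connected_refl P x : P x -> connected_in P x x.
Proof. by move=> Px; exists [::]; split => //=; rewrite Px. Qed.

Lemma connected_trans P x y z :
  connected_in P x y -> connected_in P y z -> connected_in P x z.
Proof.
move=> [p [ep Pp xy]] [p' [ep' Pp' yz]]; exists (p ++ p'); split.
- by rewrite cat_path ep xy.
- move: Pp Pp' => /= /andP[-> Pp] /andP[_ Pp']; by rewrite all_cat Pp.
- by rewrite last_cat xy.
Qed.

Lemma connected_sym P x y : connected_in P x y -> connected_in P y x.
Proof.
move=> [p [ep Pp <-]]; exists (rev (belast x p)); split.
- by rewrite rev_path (eq_path (e' := e)) // => u v; rewrite e_sym.
- by rewrite -rev_rcons all_rev -lastI.
- by case: p {ep Pp} => //= z p; rewrite rev_cons last_rcons.
Qed.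

Lemma connected_sub P Q x y : subpred P Q -> connected_in P x y -> connected_in Q x y.
Proof. by move=> PQ [p [ep /(sub_all PQ) ? <-]]; exists p. Qed.

Lemma connected_source P x y : connected_in P x y -> P x.
Proof. by move=> [p [_ /allP Pp _]]; apply: Pp; exact: mem_head. Qed.

Lemma first_hit P Q x p : path e x p -> all P (x :: p) -> Q (last x p) -> ~~ Q x ->
  exists y z, [/\ connected_in (predI P (predC Q)) x y, e y z, Q z & P z].
Proof.
elim: p x => [|x' p IH] x /=; first by move=> _ _ ->.
move=> /andP[exx' ep] /and3P[Px Px' Pp] Qlast nQx.
have [Qx'|nQx'] := boolP (Q x').
  exists x, x'; split => //; apply: connected_refl; by rewrite /= Px nQx.
have [|y [z [cy eyz Qz Pz]]] := IH x' ep _ Qlast nQx'; first by rewrite /= Px' Pp.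
exists y, z; split => //; apply: connected_trans cy.
by exists [:: x']; split => //=; rewrite ?exx' // Px nQx Px' nQx'.
Qed.

End Connection.

(* Each [Q i] is a cut set leaving at least three pieces that meet [Y]. Send [i] to the second
   smallest of the minima of the pieces not containing the least element of [Y] joined to
   [Q i]. *)
Section BurtonKeane.
Variables (V : eqType) (e : rel V) (B : pred V) (I : eqType) (T : seq I).
Variables (Q : I -> pred V) (ctr : I -> V) (Y : seq V).
Hypothesis e_sym : symmetric e.
Hypothesis uniqT : uniq T.
Hypothesis QB : {in T, forall i, subpred (Q i) B}.
Hypothesis Qin : {in T, forall i, Q i (ctr i)}.
Hypothesis Qctr : {in T, forall i v, Q i v -> connected_in e (Q i) v (ctr i)}.
Hypothesis QI : {in T &, forall i j v, Q i v -> Q j v -> i = j}.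
Hypothesis QY : {in T & Y, forall i y, ~~ Q i y}.

Local Notation conn P := (connected_in e P).
Local Notation off i := (predI B (predC (Q i))).
Local Notation idx y := (index y Y).

Hypothesis branching : {in T, forall i, exists y1 y2 y3,
  [/\ [/\ y1 \in Y, y2 \in Y & y3 \in Y],
      [/\ conn B y1 (ctr i), conn B y2 (ctr i) & conn B y3 (ctr i)] &
      [/\ ~ conn (off i) y1 y2, ~ conn (off i) y2 y3 & ~ conn (off i) y1 y3]]}.

Let Q_off i j : i \in T -> j \in T -> i != j -> subpred (Q i) (off j).
Proof.
move=> iT jT ij v Qv /=; rewrite (QB iT Qv) /=; apply/negP => /(QI iT jT Qv).
exact/eqP.
Qed.

(** Follow a path from [y] up to its first site in [Q i]. Had it met [Q j] before, it would lead to
    [ctr j] off [Q i], because [Q j] is connected. The rest of the way runs inside [Q i], which is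
    disjoint from [Q j]. *)
Let reach_avoiding i j y : i \in T -> j \in T -> i != j -> y \in Y ->
  conn B y (ctr i) -> ~ conn (off i) y (ctr j) -> conn (off j) y (ctr i).
Proof.
move=> iT jT ij yY [p [ep Bp lp]] nc.
have [|y' [z [[p' [ep' Bp' lp']] eyz Qz Bz]]] := first_hit ep Bp _ (QY iT yY).
  by rewrite lp Qin.
have avoid : all (off j) (y :: p').
  apply/allP => x xp'; have /andP[Bx nQx] := allP Bp' x xp'.
  rewrite /= Bx /=; apply/negP => Qx; apply: nc.
  apply: connected_trans (connected_sub (Q_off jT iT _) (Qctr jT Qx)); last first.
    by rewrite eq_sym.
  move: xp'; rewrite inE => /orP[/eqP ->|].
    by apply: connected_refl; move: Bp' => /= /andP[].
  move=> /splitPr xp'; case: xp' ep' Bp' => p1 p2.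
  rewrite cat_path /= => /and3P[ep1 ex _].
  rewrite /= all_cat /= => /and4P[By Bp1 Bx' _].
  exists (rcons p1 x); split; rewrite ?last_rcons // ?rcons_path ?ep1 //=.
  by rewrite By all_rcons /= Bx' Bp1.
apply: (@connected_trans _ _ _ _ y'); first by exists p'.
apply: (@connected_trans _ _ _ _ z); last exact: connected_sub (Q_off iT jT ij) (Qctr iT Qz).
have /= := Q_off iT jT ij Qz => offz.
exists [:: z]; split => //=; rewrite ?eyz // offz !andbT.
by rewrite -lp'; exact: (allP avoid _ (mem_last y p')).
Qed.

Let least (P : V -> Prop) : (exists2 y, y \in Y & P y) ->
  exists y, [/\ y \in Y, P y & forall y', y' \in Y -> P y' -> (idx y <= idx y')%N].
Proof.
move=> [y0 y0Y Py0].
have exn : exists n, `[< exists y, [/\ y \in Y, P y & idx y = n] >].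
  by exists (idx y0); apply/asboolP; exists y0.
have [n /asboolP[y [yY Py yn]] nmin] := ex_minnP exn.
exists y; split => // y' y'Y Py'; rewrite yn; apply: nmin.
by apply/asboolP; exists y'.
Qed.

(** Only what injectivity needs is recorded: [r] is the least vertex of [Y] joined to [Q i], [m] is
    the least vertex of a piece without [r], and [m'] is an earlier vertex in a third piece. *)
Let good i m := exists r m', [/\
  [/\ r \in Y, m' \in Y & m \in Y],
  [/\ conn B r (ctr i), conn B m' (ctr i) & conn B m (ctr i)],
  forall y, y \in Y -> conn B y (ctr i) -> (idx r <= idx y)%N,
  [/\ ~ conn (off i) m' r, ~ conn (off i) m r & ~ conn (off i) m' m] &
  (idx m' < idx m)%N /\
  forall y, y \in Y -> conn (off i) y m -> (idx m <= idx y)%N].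

Let goodP i : i \in T -> exists m, good i m.
Proof.
move=> iT; have [y1 [y2 [y3 [[y1Y y2Y y3Y] [c1 c2 c3] [n12 n23 n13]]]]] := branching iT.
have [|r [rY cr rmin]] := @least (fun y => conn B y (ctr i)); first by exists y1.
have offB : subpred (off i) B by move=> v /andP[].
have [u1 [u2 [[u1Y u2Y] [cu1 cu2] [nu1 nu2 nu]]]] : exists u1 u2, [/\ u1 \in Y /\ u2 \in Y,
    conn B u1 (ctr i) /\ conn B u2 (ctr i) &
    [/\ ~ conn (off i) u1 r, ~ conn (off i) u2 r & ~ conn (off i) u1 u2]].
  have both u v : ~ conn (off i) u v -> conn (off i) u r -> ~ conn (off i) v r.
    by move=> nuv ur vr; apply: nuv; apply: connected_trans ur (connected_sym e_sym vr).
  have [r1|r1] := pselect (conn (off i) y1 r).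
    by exists y2, y3; split => //; split => //; [exact: both r1|exact: both r1].
  have [r2|r2] := pselect (conn (off i) y2 r).
    by exists y1, y3; split => //; split => //; exact: both r2.
  by exists y1, y2.
have branch u : u \in Y -> conn B u (ctr i) -> exists m, [/\ m \in Y, conn (off i) m u,
    conn B m (ctr i) & forall y, y \in Y -> conn (off i) y m -> (idx m <= idx y)%N].
  move=> uY cu.
  have [|m [mY cm mmin]] := @least (fun y => conn (off i) y u).
    exists u => //; apply: connected_refl => /=.
    by rewrite (connected_source cu) /= QY.
  exists m; split => //; first exact: connected_trans (connected_sub offB cm) cu.
  by move=> y yY cy; apply: mmin => //; exact: connected_trans cy cm.
have [m1 [m1Y m1u cm1 m1min]] := branch u1 u1Y cu1.
have [m2 [m2Y m2u cm2 m2min]] := branch u2 u2Y cu2.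
have nm1 : ~ conn (off i) m1 r.
  by move=> c; apply: nu1; apply: connected_trans c; exact: connected_sym.
have nm2 : ~ conn (off i) m2 r.
  by move=> c; apply: nu2; apply: connected_trans c; exact: connected_sym.
have nm : ~ conn (off i) m1 m2.
  move=> c; apply: nu; apply: connected_trans (connected_trans c m2u).
  exact: connected_sym.
have nm' : ~ conn (off i) m2 m1 by move=> c; apply: nm; exact: connected_sym.
have [lt|lt|E] := ltngtP (idx m1) (idx m2).
- by exists m2, r, m1.
- by exists m1, r, m2.
case: nm; rewrite -(nth_index m1 m1Y) -(nth_index m1 m2Y) E nth_index //.
apply: connected_refl; exact: connected_source m2u.
Qed.

(** Suppose [Q j] lies in the piece of [y] left by [Q i]. The vertex [r], common to [i] and [j], is
    in another piece, so it reaches [Q i] without meeting [Q j]. The earlier vertex that belongs to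
    [j] is separated from [r] by [Q j], so it cannot reach [Q i] off [Q j]; hence it reaches [Q j]
    off [Q i] and lies in the piece of [y], against the minimality of [y]. *)
Let good_meet i j y : i \in T -> j \in T -> i != j -> good i y -> good j y ->
  ~ conn (off i) y (ctr j).
Proof.
move=> iT jT ij [r [m' [[rY m'Y yY] [cr _ cy] rmin [_ nyr _] [_ ymin]]]].
move=> [s [m [[sY mY _] [cs cm cy'] smin [nms _ _] [my _]]]] cyj.
have offB : subpred (off i) B by move=> v /andP[].
have cij : conn B (ctr j) (ctr i).
  by apply: connected_trans cy; exact: connected_sym.
have rs : r = s.
  have rs : idx r = idx s.
    apply/eqP; rewrite eqn_leq rmin //=; last exact: connected_trans cij.
    by apply: smin => //; apply: connected_trans cr _; exact: connected_sym.
  by rewrite -(nth_index r rY) -(nth_index r sY) rs.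
rewrite -{s}rs in sY cs smin nms.
have crj : conn (off j) r (ctr i).
  apply: reach_avoiding => // c; apply: nyr; apply: connected_trans cyj _.
  exact: connected_sym.
have cmi : conn (off i) m (ctr j).
  apply: reach_avoiding => //; first by rewrite eq_sym.
  by move=> c; apply: nms; apply: connected_trans c _; exact: connected_sym.
have : (idx y <= idx m)%N.
  by apply: ymin => //; apply: connected_trans cmi _; exact: connected_sym.
by rewrite leqNgt my.
Qed.

Lemma burton_keane : (size T <= size Y)%N.
Proof.
have /boolp.choice[g gP] : forall i, exists m, i \in T -> good i m.
  move=> i.
  have [iT|_] := boolP (i \in T); last by exists (ctr i).
  by have [m] := goodP iT; exists m.
have gY i : i \in T -> g i \in Y by move=> /gP[r [m' [[]]]].
have inj_g : {in T &, injective g}.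
  move=> i j iT jT gij; apply/eqP/negPn/negP => ij.
  have gi := gP i iT; have gj := gP j jT; rewrite -gij in gj.
  (* A path from the common value towards one of the two cut sets meets one of them first, and
     [good_meet] excludes both orders. *)
  have := good_meet iT jT ij gi gj; have [r [m' [[_ _ yY] [_ _ cy] _ _ _]]] := gi.
  move=> /(reach_avoiding iT jT ij yY cy).
  by apply: good_meet => //; rewrite eq_sym.
rewrite -(size_map g); apply: uniq_leq_size; first by rewrite map_inj_in_uniq.
by move=> y /mapP[i iT ->]; exact: gY.
Qed.

End BurtonKeane.

(** * Planarity: crossings of a box *)

Notation site := (int * int)%type.

Definition nn : rel site := fun u v =>
  (u.1 == v.1) && (`|u.2 - v.2|%N == 1%N) || (u.2 == v.2) && (`|u.1 - v.1|%N == 1%N).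

Definition star : rel site := fun u v =>
  [&& u != v, (`|(u.1 - v.1)%R| <= 1)%N & (`|(u.2 - v.2)%R| <= 1)%N].

Definition in_box (n : nat) : pred site := fun v => (`|v.1| <= n)%N && (`|v.2| <= n)%N.

Lemma nnP u v : nn u v -> [\/ v = (u.1, u.2 + 1), v = (u.1, u.2 - 1),
  v = (u.1 + 1, u.2) | v = (u.1 - 1, u.2)].
Proof.
case: u v => a b [c d]; rewrite /nn /= => /orP[]/andP[/eqP <- h].
  have [->|->] : d = b + 1 \/ d = b - 1 by lia.
    by constructor 1.
  by constructor 2.
have [->|->] : c = a + 1 \/ c = a - 1 by lia.
  by constructor 3.
by constructor 4.
Qed.

Lemma notin_cons (T : eqType) (v x : T) p :
  (v \notin x :: p) = (v != x) && (v \notin p).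
Proof. by rewrite in_cons negb_or. Qed.

(* The walk crosses the ray going down from v + (1/2, 0).  The parity of the number of such
   crossings replaces the Jordan curve theorem: it is constant along star-paths that avoid the
   walk and changes across it. *)
Definition step_below (v u u' : site) : bool :=
  [&& u.2 == u'.2, u.2 < v.2 &
    (u.1 == v.1) && (u'.1 == v.1 + 1) || (u'.1 == v.1) && (u.1 == v.1 + 1)].

Fixpoint parity_below (v x : site) (p : seq site) : bool :=
  if p is y :: p' then step_below v x y (+) parity_below v y p' else false.

Definition below (v u : site) : bool := (u.1 == v.1) && (u.2 < v.2).

(** The sites below [v'] form a half-column bounded by the two rays and by [v'], so the walk enters
    or leaves it only across a ray. If the heights differ by one, the horizontal edge in doubt ends
    at [v] or at [v'], which the walk avoids. *)
Lemma parity_below_right v v' x p : path nn x p -> v \notin x :: p -> v' \notin x :: p ->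
  v'.1 = v.1 + 1 -> (`|(v'.2 - v.2)%R| <= 1)%N ->
  parity_below v x p (+) parity_below v' x p = below v' x (+) below v' (last x p).
Proof.
move=> + + + v1 v2; elim: p x => [|y p IH] x; first by rewrite /= addbb.
rewrite [path _ _ _]/= (notin_cons v x) (notin_cons v' x).
move=> /andP[xy yp] /andP[vx vp] /andP[v'x v'p] /=.
have := IH y yp vp v'p.
have vy : v != y by apply: contraNneq vp => ->; exact: mem_head.
have v'y : v' != y by apply: contraNneq v'p => ->; exact: mem_head.
suff : step_below v x y (+) step_below v' x y = below v' x (+) below v' y.
  by case: (step_below v x y); case: (step_below v' x y); case: (below v' x); case: (below v' y);
     case: (parity_below v y p); case: (parity_below v' y p); case: (below v' _).
move: v v' x y v1 v2 xy vx v'x vy v'y {IH yp vp v'p}.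
case=> a b [_ b'] [c d] y /= -> v2 /nnP yE.
have {v2} b'E : b' = b - 1 \/ b' = b \/ b' = b + 1 by lia.
by case: yE => -> /=; case: b'E => [|[]] ->; rewrite /step_below /below /= !xpair_eqE; lia.
Qed.

(** The two rays differ by a single horizontal edge, and the lower of [v] and [v'] is an end of
    it. *)
Lemma parity_below_vertical v v' x p : path nn x p -> v \notin x :: p -> v' \notin x :: p ->
  v'.1 = v.1 -> `|(v'.2 - v.2)%R|%N = 1%N ->
  parity_below v x p = parity_below v' x p.
Proof.
move=> + + + v1 v2; elim: p x => [//|y p IH] x.
rewrite [path _ _ _]/= (notin_cons v x) (notin_cons v' x).
move=> /andP[xy yp] /andP[vx vp] /andP[v'x v'p] /=.
rewrite (IH y yp vp v'p); congr (_ (+) _).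
have vy : v != y by apply: contraNneq vp => ->; exact: mem_head.
have v'y : v' != y by apply: contraNneq v'p => ->; exact: mem_head.
move: v v' x y v1 v2 xy vx v'x vy v'y {IH yp vp v'p}.
case=> a b [_ b'] [c d] y /= -> v2 /nnP yE.
have {v2} b'E : b' = b - 1 \/ b' = b + 1 by lia.
by case: yE => -> /=; case: b'E => ->; rewrite /step_below /= !xpair_eqE; lia.
Qed.

(** The walk never goes to the left of the column of [v], so it can leave the half-column below [v]
    only across the ray. *)
Lemma parity_below_left n v x p : path nn x p -> v \notin x :: p -> v.1 = - n%:Z ->
  all (fun u : site => - n%:Z <= u.1) (x :: p) ->
  parity_below v x p = below v x (+) below v (last x p).
Proof.
move=> + + v1; elim: p x => [|y p IH] x; first by rewrite addbb.
rewrite [path _ _ _]/= (notin_cons v x) => /andP[xy yp] /andP[vx vp] /= /and3P[lx ly lp].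
rewrite (IH y yp vp) /= ?ly ?lp //.
have vy : v != y by apply: contraNneq vp => ->; exact: mem_head.
rewrite addbA; congr (_ (+) _).
move: v x y v1 xy vx vy lx ly {IH yp vp}.
case=> a b [c d] y /= -> /nnP [] -> /=; rewrite /step_below /below /= !xpair_eqE; lia.
Qed.

Lemma parity_below_bottom n v x p : v.2 = - n%:Z ->
  all (fun u : site => - n%:Z <= u.2) (x :: p) -> parity_below v x p = false.
Proof.
move=> v2; elim: p x => [//|y p IH] x /= /and3P[lx ly lp].
rewrite IH /= ?ly // addbF /step_below v2; apply/negP => /and3P[_ + _].
by rewrite ltNge lx.
Qed.

(** For [v] in the top row the ray meets every edge that the walk can use between the column of [v]
    and the next one, so the parity tells whether the walk changes sides. *)
Lemma parity_below_top n v x p : path nn x p -> v \notin x :: p -> v.2 = n%:Z ->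
  all (fun u : site => u.2 <= n%:Z) (x :: p) ->
  parity_below v x p = (x.1 <= v.1) (+) ((last x p).1 <= v.1).
Proof.
move=> + + v2; elim: p x => [|y p IH] x; first by rewrite addbb.
rewrite [path _ _ _]/= (notin_cons v x) => /andP[xy yp] /andP[vx vp] /= /and3P[lx ly lp].
rewrite (IH y yp vp) /= ?ly ?lp //.
have vy : v != y by apply: contraNneq vp => ->; exact: mem_head.
rewrite addbA; congr (_ (+) _).
move: v x y v2 xy vx vy lx ly {IH yp vp}.
case=> a b [c d] y /= -> /nnP [] -> /=; rewrite /step_below /= !xpair_eqE; lia.
Qed.

Lemma starP v v' : star v v' -> (`|(v'.2 - v.2)%R| <= 1)%N /\
  [\/ v'.1 = v.1 + 1, v.1 = v'.1 + 1 | v'.1 = v.1 /\ `|(v'.2 - v.2)%R|%N = 1%N].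
Proof.
case: v v' => a b [c d]; rewrite /star /= xpair_eqE => h; split; first by lia.
have [E|[E|[E1 E2]]] : c = a + 1 \/ a = c + 1 \/ c = a /\ `|(d - b)%R|%N = 1%N by lia.
- by constructor 1.
- by constructor 2.
- by constructor 3.
Qed.

Definition avoids (p : seq site) (v : site) := v \notin p.

Section PlanarSeparation.
Variables (n : nat) (x : site) (p : seq site).
Hypothesis path_p : path nn x p.
Hypothesis p_left : all (fun u : site => - n%:Z <= u.1) (x :: p).
Hypothesis p_top : all (fun u : site => u.2 <= n%:Z) (x :: p).
Hypothesis p_bottom : all (fun u : site => - n%:Z <= u.2) (x :: p).

(* An end of the walk with this property is not below any site of the box outside
   the leftmost column. *)
Definition exposed (u : site) := [|| u.1 == - n%:Z, u.2 == n%:Z | n%:Z < u.1].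

Hypothesis exposed_x : exposed x.
Hypothesis exposed_last : exposed (last x p).

Lemma parity_below_star v v' : star v v' -> in_box n v -> in_box n v' ->
  v \notin x :: p -> v' \notin x :: p -> parity_below v x p = parity_below v' x p.
Proof.
have exposedF u w w' : exposed u -> in_box n w -> in_box n w' -> w'.1 = w.1 + 1 ->
    below w' u = false.
  case: u w w' => a b [c d] [c' d']; rewrite /exposed /in_box /below /=.
  by move=> + + + E; rewrite {}E => eu bw bw'; apply/negP => h; lia.
have right w w' : in_box n w -> in_box n w' -> w'.1 = w.1 + 1 ->
    (`|(w'.2 - w.2)%R| <= 1)%N -> w \notin x :: p -> w' \notin x :: p ->
    parity_below w x p = parity_below w' x p.
  move=> bw bw' w1 w2 wp w'p.
  have := parity_below_right path_p wp w'p w1 w2.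
  rewrite (exposedF _ _ _ exposed_x bw bw' w1) (exposedF _ _ _ exposed_last bw bw' w1).
  by case: (parity_below w x p); case: (parity_below w' x p).
move=> /starP[d2 [E|E|[E1 E2]]] bv bv' vp v'p.
- exact: right.
- by apply/esym; apply: right => //; rewrite distnC.
- exact: (parity_below_vertical path_p).
Qed.

Lemma parity_below_star_path y s : path star y s -> all (in_box n) (y :: s) ->
  all (avoids (x :: p)) (y :: s) -> (last y s).2 = n%:Z ->
  parity_below y x p = (x.1 <= (last y s).1) (+) ((last x p).1 <= (last y s).1).
Proof.
elim: s y => [|z s IH] y.
  move=> _ _ /= /andP[yp _] y2; exact: (parity_below_top path_p yp y2 p_top).
move=> /= /andP[yz zs] /and3P[by_ bz bs] /and3P[yp zp sp] l2.
rewrite (parity_below_star yz) // (IH z) //= ?bz //.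
by rewrite zp.
Qed.

(** The parity is constant along the star-path. It vanishes at the bottom, where nothing lies below,
    and at the top it compares the sides on which the two ends of the walk lie. *)
Lemma no_crossing_bottom y s : path star y s -> all (in_box n) (y :: s) ->
  all (avoids (x :: p)) (y :: s) -> y.2 = - n%:Z -> (last y s).2 = n%:Z ->
  (x.1 <= (last y s).1) = ((last x p).1 <= (last y s).1).
Proof.
move=> ps bs dis y2 l2; have := parity_below_star_path ps bs dis l2.
rewrite (parity_below_bottom y2 p_bottom).
by case: (x.1 <= _); case: (_ <= _).
Qed.

Lemma no_crossing_left y s : path star y s -> all (in_box n) (y :: s) ->
  all (avoids (x :: p)) (y :: s) -> y.1 = - n%:Z -> (last y s).2 = n%:Z ->
  below y x (+) below y (last x p) =
  (x.1 <= (last y s).1) (+) ((last x p).1 <= (last y s).1).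
Proof.
move=> ps bs dis y1 l2; rewrite -(parity_below_star_path ps bs dis l2).
by rewrite (parity_below_left path_p _ y1 p_left) //; have /andP[] := dis.
Qed.

End PlanarSeparation.

(** * Arms across an annulus *)

Lemma last_exit (T : eqType) (Q : pred T) x p : has Q (x :: p) ->
  exists p1 x' p', [/\ x :: p = p1 ++ x' :: p', Q x' & all (predC Q) p'].
Proof.
elim: p x => [|y p IH] x; first by rewrite /= orbF => Qx; exists [::], x, [::].
have [hp _|nhp] := boolP (has Q (y :: p)).
  have [p1 [x' [p' [-> Qx' ap']]]] := IH y hp.
  by exists (x :: p1), x', p'.
rewrite [has _ _]/= => /orP[Qx|hp]; last by rewrite /= hp in nhp.
by exists [::], x, (y :: p); split; rewrite ?all_predC.
Qed.

Definition rng (n : nat) : seq int := [seq i%:Z - n%:Z | i <- iota 0 (2 * n).+1].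

Lemma mem_rng n (a : int) : (a \in rng n) = (`|a| <= n)%N.
Proof.
apply/mapP/idP => [[i]|an]; first by rewrite mem_iota => h ->; lia.
by exists `|(a + n%:Z)%R|%N; [rewrite mem_iota|]; lia.
Qed.

Lemma rng_uniq n : uniq (rng n).
Proof. by rewrite map_inj_uniq ?iota_uniq // => i j /addIr []. Qed.

Definition box_seq n : seq site := [seq (a, b) | a <- rng n, b <- rng n].

Lemma mem_box_seq n v : (v \in box_seq n) = in_box n v.
Proof.
case: v => a b; rewrite /in_box /= -!mem_rng.
by apply/allpairsP/andP => [[[c d] /= [? ? [-> ->]]]|[]] //; exists (a, b).
Qed.

Lemma box_seq_uniq n : uniq (box_seq n).
Proof.
apply: allpairs_uniq; [exact: rng_uniq|exact: rng_uniq|].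
by move=> [a b] [c d] _ _ /= [-> ->].
Qed.

Definition rim (n : nat) : pred site := fun v =>
  in_box n v && ((`|v.1| == n)%N || (`|v.2| == n)%N).

Definition rim_seq n : seq site :=
  [seq (a, n%:Z) | a <- rng n] ++ [seq (a, - n%:Z) | a <- rng n] ++
  [seq (n%:Z, a) | a <- rng n] ++ [seq (- n%:Z, a) | a <- rng n].

Lemma mem_rim_seq n v : (v \in rim_seq n) = rim n v.
Proof.
case: v => a b; rewrite !mem_cat /rim /in_box /=.
have m1 (c : int) : ((a, b) \in [seq (a, c) | a <- rng n]) = (b == c) && (`|a| <= n)%N.
  rewrite -mem_rng; apply/mapP/andP => [[d ? [-> ->]]|[/eqP -> ?]] //; by exists a.
have m2 (c : int) : ((a, b) \in [seq (c, a) | a <- rng n]) = (a == c) && (`|b| <= n)%N.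
  rewrite -mem_rng; apply/mapP/andP => [[d ? [-> ->]]|[/eqP -> ?]] //; by exists b.
by rewrite !m1 !m2; lia.
Qed.

Lemma size_rim_seq n : size (rim_seq n) = (4 * (2 * n).+1)%N.
Proof. by rewrite !size_cat !size_map size_iota; lia. Qed.

Lemma nn_star u v : nn u v -> star u v.
Proof. by case: u v => a b [c d]; rewrite /nn /star /= xpair_eqE; lia. Qed.

Lemma nn_sym : symmetric nn.
Proof. by case=> a b [c d]; rewrite /nn /=; lia. Qed.

Lemma star_sym : symmetric star.
Proof. by case=> a b [c d]; rewrite /star /= !xpair_eqE; lia. Qed.

Lemma box_connected n v : in_box n v -> connected_in nn (in_box n) v (0, 0).
Proof.
have [m] := ubnP (`|v.1| + `|v.2|)%N; elim: m v => // m IH v vm bv.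
have [->|v0] := eqVneq v (0, 0); first by apply: connected_refl; rewrite /in_box.
have [u [vu bu um]] : exists u, [/\ nn v u, in_box n u & (`|u.1| + `|u.2| < `|v.1| + `|v.2|)%N].
  case: v bv v0 {vm} => a b; rewrite /in_box /nn xpair_eqE /= => bv v0.
  have [a0|a0] := eqVneq a 0.
    exists (a, if 0 < b then b - 1 else b + 1).
    by case: ifPn => b0; split=> /=; lia.
  exists (if 0 < a then a - 1 else a + 1, b).
  by case: ifPn => b0; split=> /=; lia.
apply: connected_trans (IH u _ bu); last by lia.
by exists [:: u]; split => //=; rewrite ?vu ?bv ?bu.
Qed.

Section Arms.
Variables (n N : nat).
Implicit Types (A : pred site) (w : site -> bool).

Definition annulus : pred site := fun v => in_box N v && ~~ in_box n v.

(** The starting site lies in the inner box and its colour is left free. Thus an arm depends on the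
    annulus alone and survives any recolouring of the box. *)
Definition arm (e : rel site) A w := exists x p, [/\ in_box n x, path e x p,
  all (fun v => annulus v && w v) p & A (last x p)].

Definition crossing (e : rel site) w := arm e (rim N) w.

Lemma arm_increasing e A w w' : (forall v, w v ==> w' v) -> arm e A w -> arm e A w'.
Proof.
move=> ww' [x [p [bx ep wp Ap]]]; exists x, p; split => //.
by apply: sub_all wp => v /andP[-> /=]; exact: implyP.
Qed.

Lemma arm_depends e A : depends_on [seq v <- box_seq N | annulus v] (arm e A).
Proof.
have sub w w' : {in [seq v <- box_seq N | annulus v], w =1 w'} -> arm e A w -> arm e A w'.
  move=> ww' [x [p [bx ep wp Ap]]]; exists x, p; split => //.
  apply: sub_all wp => v /andP[av wv]; rewrite av /= -ww' // mem_filter av.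
  by rewrite mem_box_seq; case/andP: av.
move=> w w' ww'; apply/propext; split; apply: sub => // v vS; exact/esym/ww'.
Qed.

End Arms.

(** After its last visit to the box of radius [n'] the crossing stays in the thinner annulus. This
    allows a common inner radius for both colours. *)
Lemma crossing_shrink e n n' N w : (n <= n' < N)%N ->
  crossing n N e w -> crossing n' N e w.
Proof.
move=> /andP[nn' n'N] [x [p [bx ep wp rp]]].
have hx : has (in_box n') (x :: p) by rewrite /= (_ : in_box n' x) //; move: bx; rewrite /in_box; lia.
have [p1 [x' [p' [E Qx' ap']]]] := last_exit hx.
have lE : last x p = last x' p' by rewrite -(last_cons x) E last_cat last_cons.
exists x', p'; split => //; last by rewrite -lE.
  case: p1 E => [[<- <-] //|y p1] [_ E].
  by move: ep; rewrite E cat_path /= => /and3P[].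
case: p1 E => [[_ E]|y p1 [_ E]]; move: wp; rewrite E ?all_cat /=.
  move=> wp; apply/allP => v vp; have := allP wp v vp; have := allP ap' v vp.
  by rewrite /annulus /= => -> /andP[/andP[-> _] ->].
case/andP=> _ /andP[_ wp]; apply/allP => v vp; have := allP wp v vp; have := allP ap' v vp.
by rewrite /annulus /= => -> /andP[/andP[-> _] ->].
Qed.

(** Clockwise, the arcs [bottom_left], [left_low], [left_up], [top_left], [top_right], [right_up]
    will receive arms that are white and black in turn. They are closed, so consecutive ones may
    share a site. *)
Definition left_low N : pred site := fun v => [&& in_box N v, v.1 == - N%:Z & v.2 <= 0].
Definition left_up N : pred site := fun v => [&& in_box N v, v.1 == - N%:Z & 0 <= v.2].
Definition top_left N : pred site := fun v => [&& in_box N v, v.2 == N%:Z & v.1 <= 0].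
Definition top_right N : pred site := fun v => [&& in_box N v, v.2 == N%:Z & 0 <= v.1].
Definition right_up N : pred site := fun v => [&& in_box N v, v.1 == N%:Z & 0 <= v.2].
Definition bottom_left N : pred site := fun v => [&& in_box N v, v.2 == - N%:Z & v.1 <= 0].

Lemma in_box_neq N z b : in_box N z -> z != (N%:Z + 1, b).
Proof. by case: z => c d; rewrite xpair_eqE /in_box /= => h; apply/negP => /andP[/eqP E _]; lia. Qed.

Lemma right_up_nn N v : right_up N v -> nn v (N%:Z + 1, v.2).
Proof.
case: v => c d /and3P[_ /eqP /= -> _]; rewrite /nn /= eqxx /=; apply/orP; right.
by rewrite (_ : N%:Z - _ = -1) //; lia.
Qed.

Lemma left_exposed N u : left_low N u || top_left N u -> exposed N u.
Proof. by rewrite /exposed => /orP[]/and3P[_ -> _] //; rewrite orbT. Qed.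

Lemma left_le_top N u z : left_low N u || top_left N u -> top_right N z -> u.1 <= z.1.
Proof.
move=> uL /and3P[/andP[zN _] _ z0]; case/orP: uL => /and3P[_ /eqP + u0].
  by move=> ->; move: z.1 zN => c; clear; lia.
by move=> _; exact: le_trans u0 z0.
Qed.

Section Separation.
Variables (n N : nat) (w : site -> bool).
Hypothesis nN : (n < N)%N.

Local Notation white := (fun v => ~~ w v).
Local Notation ring_black := (fun v => annulus n N v && w v).

(** The inner box serves as a junction whatever its colours, since the black walks to be separated
    stay in the annulus. *)
Lemma white_chain A A' : arm n N star A white -> arm n N star A' white ->
  exists y s, [/\ path star y s,
    all (fun v => in_box N v && (in_box n v || ~~ w v)) (y :: s), A y & A' (last y s)].
Proof.
move=> [x [p [bx ep wp Ap]]] [x' [p' [bx' ep' wp' Ap']]].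
pose P : pred site := fun v => in_box N v && (in_box n v || ~~ w v).
have boxP : subpred (in_box n) P.
  by move=> v bv; rewrite /P bv andbT; move: bv; rewrite /in_box; lia.
have c y q : in_box n y -> path star y q -> all (fun v => annulus n N v && ~~ w v) q ->
    connected_in star P y (last y q).
  move=> by_ eq wq; exists q; split => //=; rewrite boxP //=.
  by apply: sub_all wq => v /andP[/andP[bv _] wv]; rewrite /P bv wv orbT.
have cb y : in_box n y -> connected_in star P y (0, 0).
  move=> /box_connected[q [eq bq lq]]; exists q; split => //; last exact: sub_all bq.
  by apply: sub_path eq => u v; exact: nn_star.
have : connected_in star P (last x p) (last x' p').
  apply: connected_trans (connected_sym star_sym (c _ _ bx ep wp)) _.
  apply: connected_trans (cb _ bx) _.
  exact: connected_trans (connected_sym star_sym (cb _ bx')) (c _ _ bx' ep' wp').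
by move=> [s [es Ps ls]]; exists (last x p), s; rewrite ls.
Qed.

Let disjoint_walks u q y s : all ring_black (u :: q) ->
  all (fun v => in_box N v && (in_box n v || ~~ w v)) (y :: s) ->
  all (avoids (u :: q)) (y :: s).
Proof.
move=> bq; apply: sub_all => v /andP[_ wv]; apply/negP => vq.
by have := allP bq v vq; rewrite /annulus -andbA => /and3P[_ nb bw]; rewrite bw (negbTE nb) in wv.
Qed.

Hypothesis white_left : arm n N star (left_up N) white.
Hypothesis white_top : arm n N star (top_right N) white.
Hypothesis white_bottom : arm n N star (bottom_left N) white.

Let box_bounds q : all ring_black q ->
  [/\ all (fun u : site => - N%:Z <= u.1) q, all (fun u : site => u.2 <= N%:Z) q &
      all (fun u : site => - N%:Z <= u.2) q].
Proof.
by move=> bq; split; apply: sub_all bq => -[a b]; rewrite /annulus /in_box /=; lia.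
Qed.

Lemma separated_left_top u v : left_low N u -> top_left N v ->
  ~ connected_in nn ring_black u v.
Proof.
move=> uL vT [p [ep bp lp]].
have [y [s [es ws yL lT]]] := white_chain white_left white_top.
have dis := disjoint_walks bp ws.
have [b1 b2 b3] := box_bounds bp.
have yu : y != u.
  by have /andP[+ _] := dis; rewrite /avoids notin_cons => /andP[].
have inb : all (in_box N) (y :: s) by apply: sub_all ws => z /andP[].
have y1 : y.1 = - N%:Z by case/and3P: yL => _ /eqP.
have l2 : (last y s).2 = N%:Z by case/and3P: lT => _ /eqP.
have eu : exposed N u by case/and3P: uL => _ u1 _; rewrite /exposed u1.
have ev : exposed N (last u p).
  by rewrite lp; case/and3P: vT => _ v2 _; rewrite /exposed v2 orbT.
(* The left-hand side is true, since [u] lies below [y] in the left column and the end on the top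
   side does not. The right-hand side is false, since neither end lies to the right of the end of
   the chain. *)
have := no_crossing_left ep b1 b2 b3 eu ev es inb dis y1 l2.
rewrite lp; move: uL vT yL lT yu; move: (last y s) => z.
case: u v y z {ep bp lp es ws dis b1 b2 b3 inb y1 l2 eu ev} => a b [c d] [a' b'] [c' d'].
rewrite /left_low /top_left /left_up /top_right /below /in_box /=.
move=> /and3P[/andP[_ _] /eqP -> b0] /and3P[/andP[_ _] /eqP -> c0].
move=> /and3P[/andP[_ bN] /eqP -> b'0] /and3P[/andP[cN _] _ c'0] yu.
have bb' : b < b'.
  by rewrite lt_neqAle (le_trans b0 b'0) andbT; apply: contraNneq yu => ->.
rewrite eqxx bb' (ltNge N%:Z) (_ : b' <= N%:Z) ?andbF /=; last by lia.
by rewrite (le_trans c0 c'0) (_ : - N%:Z <= c') //; lia.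
Qed.

(** The black walk is prolonged by one step into the column [N + 1]. Its end is then exposed, and it
    lies strictly to the right of the upper end of the white chain even when that is the corner. *)
Lemma separated_right u v : left_low N u || top_left N u -> right_up N v ->
  ~ connected_in nn ring_black u v.
Proof.
move=> uL vR [p [ep bp lp]].
have [y [s [es ws yL lT]]] := white_chain white_bottom white_top.
have inb : all (in_box N) (y :: s) by apply: sub_all ws => z /andP[].
have dis : all (avoids (u :: rcons p (N%:Z + 1, v.2))) (y :: s).
  apply/allP => z zs; have := allP (disjoint_walks bp ws) z zs; have := allP inb z zs.
  rewrite /avoids -rcons_cons mem_rcons in_cons negb_or => bz ->; rewrite andbT.
  exact: in_box_neq.
have [b1 b2 b3] := box_bounds bp.
have ep' : path nn u (rcons p (N%:Z + 1, v.2)).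
  by rewrite rcons_path ep lp right_up_nn.
have bend (P : pred site) : all P (u :: p) -> P (N%:Z + 1, v.2) ->
    all P (u :: rcons p (N%:Z + 1, v.2)).
  by move=> pP Pe; rewrite -rcons_cons all_rcons Pe.
have [v21 v22] : - N%:Z <= v.2 /\ v.2 <= N%:Z.
  by case/and3P: vR => /andP[_ +] _ _; move: v.2 => b; clear; lia.
have eu : exposed N u by exact: left_exposed.
have ev : exposed N (last u (rcons p (N%:Z + 1, v.2))).
  by rewrite last_rcons /exposed /= ltrDl ltr01 !orbT.
have y2 : y.2 = - N%:Z by case/and3P: yL => _ /eqP.
have l2 : (last y s).2 = N%:Z by case/and3P: lT => _ /eqP.
have v1 : - N%:Z <= N%:Z + 1 by clear; lia.
have := no_crossing_bottom ep' (bend _ b1 v1) (bend _ b2 v22) (bend _ b3 v21) eu ev es inb dis y2 l2.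
rewrite last_rcons (left_le_top uL lT) /= => /esym.
by case/and3P: lT => /andP[+ _] _ _; move: (last y s).1 => z; clear; lia.
Qed.

End Separation.

(** * Symmetries of the square *)

Definition flip_if (b : bool) (x : int) := if b then - x else x.

Definition dihedral (g : bool * bool * bool) (v : site) : site :=
  let: (s, a, b) := g in
  let z := if s then (v.2, v.1) else v in (flip_if a z.1, flip_if b z.2).

Definition dihedral_inv (g : bool * bool * bool) :=
  let: (s, a, b) := g in if s then (s, b, a) else g.

Lemma flip_ifK b : involutive (flip_if b).
Proof. by case: b => x //=; rewrite opprK. Qed.

Lemma abs_flip_if b x : `|flip_if b x|%N = `|x|%N.
Proof. by case: b => //=; exact: abszN. Qed.

Lemma flip_ifB b x y : flip_if b x - flip_if b y = flip_if b (x - y).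
Proof. by case: b => //=; rewrite opprB opprK addrC. Qed.

Lemma flip_if_eq b x y : (flip_if b x == flip_if b y) = (x == y).
Proof. exact/inj_eq/inv_inj/flip_ifK. Qed.

Lemma dihedralK g : cancel (dihedral g) (dihedral (dihedral_inv g)).
Proof. by case: g => -[[] a] b [x y] /=; rewrite !flip_ifK. Qed.

Lemma dihedral_box g n v : in_box n (dihedral g v) = in_box n v.
Proof. by case: g => -[[] a] b; case: v => x y; rewrite /in_box /= !abs_flip_if // andbC. Qed.

Lemma dihedral_nn g u v : nn (dihedral g u) (dihedral g v) = nn u v.
Proof.
case: g => -[[] a] b; case: u v => x y [z t]; rewrite /nn /= !flip_ifB !abs_flip_if !flip_if_eq //.
by rewrite orbC.
Qed.

Lemma dihedral_star g u v : star (dihedral g u) (dihedral g v) = star u v.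
Proof.
case: g => -[[] a] b; case: u v => x y [z t].
  rewrite /star /= !flip_ifB !abs_flip_if !xpair_eqE !flip_if_eq.
  by rewrite [(y == t) && _]andbC [X in _ && X]andbC.
by rewrite /star /= !flip_ifB !abs_flip_if !xpair_eqE !flip_if_eq.
Qed.

Lemma rim_half_side N v : rim N v -> exists g, top_right N (dihedral g v).
Proof.
case: v => x y; rewrite /rim => /andP[bv /orP[]/eqP /= E].
  exists (true, y < 0, x < 0); apply/and3P; split; first by rewrite dihedral_box.
    by rewrite /= /flip_if; case: ifP => x0; apply/eqP; lia.
  by rewrite /= /flip_if; case: ifP => x0; lia.
exists (false, x < 0, y < 0); apply/and3P; split; first by rewrite dihedral_box.
  by rewrite /= /flip_if; case: ifP => x0; apply/eqP; lia.
by rewrite /= /flip_if; case: ifP => x0; lia.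
Qed.

Definition half_side N g : pred site := fun v => top_right N (dihedral g v).

Lemma left_lowE N : left_low N =1 half_side N (true, true, true).
Proof. by case=> x y; rewrite /half_side /left_low /top_right dihedral_box /=; congr [&& _, _ & _]; lia. Qed.
Lemma left_upE N : left_up N =1 half_side N (true, false, true).
Proof. by case=> x y; rewrite /half_side /left_up /top_right dihedral_box /=; congr [&& _, _ & _]; lia. Qed.
Lemma top_leftE N : top_left N =1 half_side N (false, true, false).
Proof. by case=> x y; rewrite /half_side /top_left /top_right dihedral_box /=; congr [&& _, _ & _]; lia. Qed.
Lemma top_rightE N : top_right N =1 half_side N (false, false, false).
Proof. by case=> x y; rewrite /half_side /top_right. Qed.
Lemma right_upE N : right_up N =1 half_side N (true, false, false).
Proof. by case=> x y; rewrite /half_side /right_up /top_right dihedral_box /=; congr [&& _, _ & _]; lia. Qed.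
Lemma bottom_leftE N : bottom_left N =1 half_side N (false, true, true).
Proof. by case=> x y; rewrite /half_side /bottom_left /top_right dihedral_box /=; congr [&& _, _ & _]; lia. Qed.

Lemma eq_arm n N e A A' w : A =1 A' -> arm n N e A w = arm n N e A' w.
Proof. by move=> AA'; congr (arm n N e _ w); apply: funext. Qed.

Lemma arm_comp n N e A w (g : site -> site) :
  (forall k v, in_box k (g v) = in_box k v) -> (forall u v, e (g u) (g v) = e u v) ->
  arm n N e (A \o g) (w \o g) -> arm n N e A w.
Proof.
move=> gbox ge [x [p [bx ep wp Ap]]]; exists (g x), (map g p); split.
- by rewrite gbox.
- by rewrite path_map (eq_path ge).
- rewrite all_map; apply: sub_all wp => v /=.
  by rewrite /annulus !gbox.
- by rewrite last_map.
Qed.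

Section Indicator.
Variable R : realFieldType.

Definition ind (P : Prop) : R := (`[< P >])%:R.

Lemma ind_le (P Q : Prop) : (P -> Q) -> ind P <= ind Q.
Proof.
move=> PQ; rewrite /ind ler_nat; case: (asboolP P) => // p.
by rewrite asboolT //; exact: PQ.
Qed.

Lemma ind_ge0 P : 0 <= ind P. Proof. exact: ler0n. Qed.

Lemma ind_le1 P : ind P <= 1. Proof. by rewrite /ind lern1; case: asbool. Qed.

Lemma indT (P : Prop) : P -> ind P = 1. Proof. by move=> p; rewrite /ind asboolT. Qed.

Lemma indF (P : Prop) : ~ P -> ind P = 0. Proof. by move=> p; rewrite /ind asboolF. Qed.

Lemma indN (P : Prop) : ind (~ P) = 1 - ind P.
Proof.
have [p|np] := pselect P; last by rewrite (indT np) (indF np) subr0.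
by rewrite (indT p) indF ?subrr.
Qed.

End Indicator.
Arguments ind {R}.

Section SquareRootTrick.
Variables (R : realFieldType) (q : R).
Hypothesis q01 : 0 <= q <= 1.

Let decreasing (f : (site -> bool) -> R) := forall w w', (forall v, w v ==> w' v) -> f w' <= f w.

Lemma harris_decreasing S (f g : (site -> bool) -> R) w : decreasing f -> decreasing g ->
  expect (coin q) S f w * expect (coin q) S g w <= expect (coin q) S (fun w => f w * g w) w.
Proof.
move=> df dg.
have incN h : decreasing h -> increasing (fun w => - h w).
  by move=> dh w1 w2 w12; rewrite lerN2; exact: dh.
have := harris q01 S w (incN _ df) (incN _ dg).
rewrite !expect_opp mulrNN => /le_trans; apply; apply: expect_le; first exact: coin_ge0.
by move=> w'; rewrite mulrNN.
Qed.

Lemma harris_prod (I : Type) (r : seq I) (F : I -> (site -> bool) -> R) S w :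
  (forall i, decreasing (F i)) -> (forall i w, 0 <= F i w) ->
  \prod_(i <- r) expect (coin q) S (F i) w <=
  expect (coin q) S (fun w => \prod_(i <- r) F i w) w.
Proof.
move=> dF F0; elim: r => [|i r IH].
  rewrite big_nil -[leLHS](expect_cst (coin_sum1 q) S 1 w).
  by apply: expect_le => [|w']; [exact: coin_ge0|rewrite big_nil].
rewrite big_cons.
have E0 : 0 <= expect (coin q) S (F i) w by apply: expect_ge0 => //; [exact: coin_ge0|exact: coin_sum1].
apply: le_trans (ler_wpM2l E0 IH) _.
apply: le_trans (harris_decreasing _ _ (dF i) _) _ => [w1 w2 w12|].
  apply: ler_prod => j _; rewrite F0 /=; exact: dF.
by apply: expect_le => [|w']; [exact: coin_ge0|rewrite big_cons].
Qed.

Variables (n N : nat) (e : rel site).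
Hypothesis e_dihedral : forall g u v, e (dihedral g u) (dihedral g v) = e u v.

Definition prob (f : (site -> bool) -> R) := expect (coin q) (box_seq N) f xpred0.

(** The box is invariant and its sites are identically distributed. An inequality suffices: used
    again for the inverse symmetry, it gives equality. *)
Lemma prob_arm_dihedral A g :
  prob (fun w => ind (arm n N e (A \o dihedral g) w)) <= prob (fun w => ind (arm n N e A w)).
Proof.
have dinj h : injective (dihedral h) := can_inj (dihedralK h).
rewrite /prob.
have := expect_map (coin q) (box_seq N) (fun w => ind (arm n N e (A \o dihedral g) w)) xpred0 (dinj g).
rewrite (_ : xpred0 \o dihedral g = xpred0) // => <-.
rewrite (@expect_perm _ _ _ (coin q) _ (box_seq N)).
  apply: expect_le => [|w]; first exact: coin_ge0.
  apply: ind_le; apply: arm_comp => [k v|u v]; [exact: dihedral_box|exact: e_dihedral].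
apply: uniq_perm; rewrite ?map_inj_uniq ?box_seq_uniq //.
move=> v; rewrite mem_box_seq; apply/mapP/idP => [[u + ->]|bv].
  by rewrite mem_box_seq dihedral_box.
have ginvK : dihedral g (dihedral (dihedral_inv g) v) = v.
  by have := dihedralK (dihedral_inv g) v; case: (g) => -[[] a] b.
by exists (dihedral (dihedral_inv g) v); rewrite ?ginvK // mem_box_seq dihedral_box.
Qed.

Lemma prob_half_side g h : prob (fun w => ind (arm n N e (half_side N g) w)) =
  prob (fun w => ind (arm n N e (half_side N h) w)).
Proof.
suff E k : prob (fun w => ind (arm n N e (half_side N k) w)) =
    prob (fun w => ind (arm n N e (top_right N) w)) by rewrite !E.
apply/eqP; rewrite eq_le prob_arm_dihedral /=.
rewrite (_ : top_right N = half_side N k \o dihedral (dihedral_inv k)).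
  exact: prob_arm_dihedral.
apply: funext => v; rewrite /half_side /=; congr (top_right N _).
by have := dihedralK (dihedral_inv k) v; case: (k) => -[[] a] b.
Qed.

(* A crossing ends in one of eight half-sides, which are equivalent under the dihedral group;
   by Harris' inequality its failure probability is at least the product of theirs. *)
Lemma square_root_trick eta g : 0 <= eta ->
  prob (fun w => ind (~ crossing n N e w)) < eta ^+ 8 ->
  prob (fun w => ind (~ arm n N e (half_side N g) w)) < eta.
Proof.
move=> eta0; apply: contraTT; rewrite -!leNgt => le_eta.
pose F h w : R := ind (~ arm n N e (half_side N h) w).
have E h : prob (F h) = prob (F g).
  have P1 k : prob (F k) = 1 - prob (fun w => ind (arm n N e (half_side N k) w)).
    rewrite /prob -[1](expect_cst (coin_sum1 q) (box_seq N) 1 xpred0) -expect_opp -expect_add.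
    by apply: expect_ext => w; rewrite /F indN.
  by rewrite !P1 (prob_half_side h g).
apply: (@le_trans _ _ (\prod_(h : bool * bool * bool) prob (F h))).
  rewrite (eq_bigr (fun=> prob (F g))) => [|h _]; last exact: E.
  rewrite prodr_const !card_prod card_bool lerXn2r // nnegrE.
  exact: le_trans eta0 le_eta.
apply: le_trans (@harris_prod _ _ F _ _ _ _) _.
- move=> h w w' ww'; apply: ind_le; apply: contra_not; exact: arm_increasing.
- by move=> h w; exact: ind_ge0.
apply: expect_le => [|w]; first exact: coin_ge0.
have [cr|ncr] := pselect (crossing n N e w); last first.
  rewrite (indT _ ncr); apply: prodr_ile1 => h _.
  by rewrite /F ind_ge0 ind_le1.
case: cr => x [p [bx ep wp rp]].
have [h hp] := rim_half_side rp.
rewrite (bigD1 h) //= /F indF ?mul0r ?ind_ge0 //.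
by apply: contrapT => /contrapT; apply; exists x, p.
Qed.

End SquareRootTrick.

(** * Six arms and the blocking dichotomy *)

Lemma first_exit (T : eqType) (Q : pred T) x p : Q x -> ~~ Q (last x p) ->
  exists p1 y p2, [/\ p = p1 ++ y :: p2, all Q (x :: p1) & ~~ Q y].
Proof.
elim: p x => [|y p IH] x Qx /=; first by rewrite Qx.
have [Qy lp|nQy _] := boolP (Q y); last by exists [::], y, p; rewrite /= Qx.
have [p1 [y' [p2 [-> Qp1 nQ]]]] := IH y Qy lp.
by exists (y :: p1), y', p2; split => //=; rewrite Qx.
Qed.

Lemma connected_map (V V' : eqType) (e : rel V) (e' : rel V') (f : V -> V') (P : pred V)
    (P' : pred V') x y : (forall u v, e u v -> e' (f u) (f v)) -> (forall u, P u -> P' (f u)) ->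
  connected_in e P x y -> connected_in e' P' (f x) (f y).
Proof.
move=> fe fP [p [ep Pp <-]]; exists (map f p); split; last by rewrite last_map.
  by rewrite path_map; apply: sub_path ep => u v; exact: fe.
by rewrite -map_cons all_map; apply: sub_all Pp => u; exact: fP.
Qed.

Definition shift (z v : site) : site := (v.1 + z.1, v.2 + z.2).
Definition unshift (z v : site) : site := (v.1 - z.1, v.2 - z.2).

Lemma shiftK z : cancel (shift z) (unshift z).
Proof. by case=> a b; rewrite /shift /unshift /= !addrK. Qed.

Lemma unshiftK z : cancel (unshift z) (shift z).
Proof. by case=> a b; rewrite /shift /unshift /= !subrK. Qed.

Lemma shift_nn z u v : nn (shift z u) (shift z v) = nn u v.
Proof.
have E (x y t : int) : x + t - (y + t) = x - y by ring.
by case: u v => a b [c d]; rewrite /nn /shift /= !(inj_eq (addIr _)) !E.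
Qed.

Lemma unshift_nn z u v : nn (unshift z u) (unshift z v) = nn u v.
Proof. by rewrite -(shift_nn z) !unshiftK. Qed.

Section CutCounting.
Variables (n M : nat) (w : site -> bool).
Local Notation N := (2 * M)%N.

Definition arms6 (n N : nat) (w : site -> bool) : Prop :=
  [/\ arm n N nn (left_low N) w, arm n N nn (top_left N) w, arm n N nn (right_up N) w &
   [/\ arm n N star (left_up N) (negb \o w), arm n N star (top_right N) (negb \o w) &
       arm n N star (bottom_left N) (negb \o w)]].

(** The black box is the connected set that plays [Q i] in the counting argument. *)
Definition cut_box (n N : nat) (w : site -> bool) : Prop :=
  (forall v, in_box n v -> w v) /\ arms6 n N w.

Variable z : site.
Hypothesis zM : (`|z.1| + n < M)%N && (`|z.2| + n < M)%N.
Hypothesis cut_z : cut_box n N (w \o shift z).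

Local Notation black := (fun v => in_box M v && w v).
Local Notation Q := (fun v => in_box n (unshift z v)).
Local Notation ring_black := (fun v => annulus n N (unshift z v) && w v).

Lemma cut_box_black v : Q v -> black v.
Proof.
move=> Qv; have [+ _] := cut_z; move=> /(_ _ Qv) /=; rewrite unshiftK => ->.
rewrite andbT; move: Qv zM; case: (z) (v) => a b [c d].
by rewrite /in_box /unshift /=; clear; lia.
Qed.

Lemma cut_box_center v : Q v -> connected_in nn Q v z.
Proof.
move=> /box_connected c.
have := @connected_map _ _ nn nn (shift z) (in_box n) Q _ _ _ _ c.
rewrite unshiftK /shift /= !add0r -surjective_pairing; apply.
  by move=> u u'; rewrite shift_nn.
by move=> u; rewrite shiftK.
Qed.

Lemma in_box_last_step u v m : nn u v -> in_box m u -> ~~ in_box m v -> rim m.+1 v.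
Proof.
by move=> /nnP; case: u v => a b [c d] []->; rewrite /rim /in_box /=; clear; lia.
Qed.

(** The rim of radius [2 * M] about [z] lies outside the box of radius [M] about the origin, so the
    arm has to leave that box. Here [y] is its first site on the rim of radius [M]: the initial part
    joins [y] to the cut box, the rest joins it to the arc. *)
Lemma arm_exit (A : pred site) : (forall v, A v -> rim N v) -> arm n N nn A (w \o shift z) ->
  exists y a, [/\ y \in rim_seq M, connected_in nn black y z, A a &
    connected_in nn ring_black y (shift z a)].
Proof.
move=> AN [x [p [bx ep wp Ap]]].
have M0 : M = M.-1.+1 by case: (M) zM => //; rewrite ltn0.
have bxM : in_box M.-1 (shift z x).
  move: bx zM; case: (z) (x) => a b [c d]; rewrite /in_box /shift /=; clear; lia.
have lM : ~~ in_box M.-1 (last (shift z x) (map (shift z) p)).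
  rewrite last_map; move: (AN _ Ap) zM; case: (z) (last x p) => a b [c d].
  by rewrite /rim /in_box /shift /=; clear; lia.
have [p1 [y [p2 [E Mp1 nMy]]]] := first_exit bxM lM.
have epz : path nn (shift z x) (map (shift z) p).
  by rewrite path_map; apply: sub_path ep => u v /=; rewrite shift_nn.
have wpz : all ring_black (map (shift z) p).
  by rewrite all_map; apply: sub_all wp => v /=; rewrite shiftK.
rewrite E cat_path /= in epz; move: epz => /and3P[ep1 e1y ep2].
rewrite E all_cat /= in wpz; move: wpz => /and3P[wp1 wy wp2].
have Mz : in_box M.-1 (last (shift z x) p1) by apply: (allP Mp1); exact: mem_last.
have yr : rim M y by rewrite M0; exact: in_box_last_step Mz nMy.
have Qx : Q (shift z x) by rewrite shiftK.
exists y, (last x p); split => //; first by rewrite mem_rim_seq.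
  apply: connected_trans (connected_sub _ (cut_box_center Qx)); last exact: cut_box_black.
  apply: (connected_sym nn_sym).
  have bM v : in_box M.-1 v -> in_box M v by rewrite /in_box; case: (v) => a b /=; clear; lia.
  exists (rcons p1 y); rewrite rcons_path ep1 e1y last_rcons; split => //.
  rewrite -rcons_cons all_rcons; apply/andP; split.
    by have /andP[_ ->] := wy; rewrite andbT; case/andP: yr.
  apply/allP => v vp; rewrite bM ?(allP Mp1 v vp) //=.
  move: vp; rewrite in_cons => /orP[/eqP ->|vp]; first by have /andP[] := cut_box_black Qx.
  by have /andP[_] := allP wp1 v vp.
exists p2; split; rewrite //= ?wy //.
by rewrite -(last_map (shift z)) E last_cat.
Qed.

(** Off [Q], the box of radius [M] lies in the annulus about [z]. A connection there, prolonged by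
    the outer parts of the two arms, would join their arcs within the annulus. *)
Lemma arms_separated y y' a a' : connected_in nn ring_black y (shift z a) ->
  connected_in nn ring_black y' (shift z a') ->
  ~ connected_in nn (fun v => annulus n N v && (w \o shift z) v) a a' ->
  ~ connected_in nn (predI black (predC Q)) y y'.
Proof.
move=> ya ya' naa' yy'; apply: naa'.
have sub : subpred (predI black (predC Q)) ring_black.
  move=> v /andP[/andP[bv wv] nQ]; rewrite wv andbT /annulus.
  rewrite -[X in _ && X]/(predC Q v) nQ andbT.
  move: bv zM; case: (z) (v) => b c [d e]; rewrite /in_box /unshift /=; clear; lia.
have c : connected_in nn ring_black (shift z a) (shift z a').
  apply: connected_trans (connected_sym nn_sym ya) _.
  exact: connected_trans (connected_sub sub yy') ya'.
rewrite -(shiftK z a) -(shiftK z a'); apply: connected_map c => [u v|u].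
  by rewrite unshift_nn.
by rewrite /= unshiftK.
Qed.

Lemma cut_box_branching : exists y1 y2 y3,
  [/\ [/\ y1 \in rim_seq M, y2 \in rim_seq M & y3 \in rim_seq M],
      [/\ connected_in nn black y1 z, connected_in nn black y2 z & connected_in nn black y3 z] &
      [/\ ~ connected_in nn (predI black (predC Q)) y1 y2,
          ~ connected_in nn (predI black (predC Q)) y2 y3 &
          ~ connected_in nn (predI black (predC Q)) y1 y3]].
Proof.
have [_ [aL aT aR [wL wT wB]]] := cut_z.
have nN : (n < N)%N by move: zM; clear; lia.
have [|y1 [a1 [y1r y1z A1 c1]]] := arm_exit _ aL.
  by case=> a b; rewrite /left_low /rim /in_box /=; clear; lia.
have [|y2 [a2 [y2r y2z A2 c2]]] := arm_exit _ aT.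
  by case=> a b; rewrite /top_left /rim /in_box /=; clear; lia.
have [|y3 [a3 [y3r y3z A3 c3]]] := arm_exit _ aR.
  by case=> a b; rewrite /right_up /rim /in_box /=; clear; lia.
exists y1, y2, y3; split => //; split.
- by apply: arms_separated c1 c2 _; exact: separated_left_top.
- by apply: arms_separated c2 c3 _; apply: separated_right => //; rewrite A2 orbT.
- by apply: arms_separated c1 c3 _; apply: separated_right => //; rewrite A1.
Qed.

End CutCounting.

Lemma cut_box_count n M (Z : seq site) w : uniq Z ->
  {in Z, forall z, (`|z.1| + n < M)%N && (`|z.2| + n < M)%N} ->
  {in Z &, forall z z' v, in_box n (unshift z v) -> in_box n (unshift z' v) -> z = z'} ->
  (size [seq z <- Z | `[< cut_box n (2 * M) (w \o shift z) >]] <= 4 * (2 * M).+1)%N.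
Proof.
move=> uZ ZM ZI; rewrite -size_rim_seq.
have TZ z : z \in [seq z <- Z | `[< cut_box n (2 * M) (w \o shift z) >]] ->
    (z \in Z) * cut_box n (2 * M) (w \o shift z).
  by rewrite mem_filter => /andP[/asboolP].
apply: (@burton_keane _ nn (fun v => in_box M v && w v) _ _
  (fun z v => in_box n (unshift z v)) id) => //.
- exact: nn_sym.
- exact: filter_uniq.
- by move=> z /TZ[/ZM zM cz] v; exact: cut_box_black.
- by move=> z _; rewrite /unshift /in_box !subrr.
- by move=> z /TZ[/ZM zM cz] v; exact: cut_box_center.
- by move=> z z' /TZ[zZ _] /TZ[z'Z _] v; exact: ZI.
- move=> z y /TZ[/ZM + _]; rewrite mem_rim_seq; case: (z) (y) => a b [c d].
  by rewrite /rim /in_box /unshift /=; clear; lia.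
- by move=> z /TZ[/ZM zM cz]; exact: cut_box_branching.
Qed.

Lemma expect_coin_ge (R : realFieldType) (V : eqType) (q : R) (S : seq V)
    (f : (V -> bool) -> R) w : 0 <= q <= 1 -> (forall w, 0 <= f w) ->
  (forall w' : V -> bool, {in S, forall v, w' v} -> 1 <= f w') ->
  q ^+ size S <= expect (coin q) S f w.
Proof.
move=> q01 f0 f1; have /andP[q0 q1] := q01.
suff gen S' (w' : V -> bool) : (forall w2 : V -> bool, {in S', forall v, w2 v} ->
    {in predC (mem S'), w2 =1 w'} -> 1 <= f w2) -> q ^+ size S' <= expect (coin q) S' f w'.
  by apply: gen => w2 w2S _; exact: f1.
elim: S' w' => [|v S' IH] w' f1' /=; first by rewrite expr0; exact: f1'.
rewrite big_bool /= exprS.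
have nn0 : 0 <= (1 - q) * expect (coin q) S' f (upd w' v false).
  rewrite mulr_ge0 ?subr_ge0 //.
  by apply: expect_ge0 => //; [exact: coin_ge0|exact: coin_sum1].
apply: (@le_trans _ _ (q * expect (coin q) S' f (upd w' v true))); last by rewrite lerDl.
apply: ler_wpM2l => //; apply: IH => w2 w2S w2v; apply: f1' => u.
  rewrite inE => /orP[/eqP ->|]; last exact: w2S.
  have [/w2S //|vS] := boolP (v \in S').
  by rewrite (w2v v) // /upd eqxx.
rewrite !inE negb_or => /andP[uv uS].
by rewrite (w2v u) // /upd (negbTE uv).
Qed.

Lemma ind_depends (R : realFieldType) (V : eqType) (St : finType) (S : seq V)
    (P : (V -> St) -> Prop) :
  depends_on S P -> depends_on S (fun w => ind (P w) : R).
Proof. by move=> dP w w' ww'; rewrite (dP w w'). Qed.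

Lemma depends_sub (A : Type) (V : eqType) (St : finType) (S T : seq V) (f : (V -> St) -> A) :
  {subset S <= T} -> depends_on S f -> depends_on T f.
Proof. by move=> ST df w w' ww'; apply: df => v /ST; exact: ww'. Qed.

(** * Blockable crossings and the probability of six arms *)

Section Dichotomy.
Variables (R : archiRealFieldType).
Implicit Types (q : R).

Definition blockable (e : rel site) q := exists2 eps : R, 0 < eps &
  forall n, exists2 N, (n < N)%N & eps <= prob q N (fun w => ind (~ crossing n N e w)).

Lemma not_blockable e q eps : 0 < eps -> ~ blockable e q -> exists n, forall N, (n < N)%N ->
  prob q N (fun w => ind (~ crossing n N e w)) < eps.
Proof.
move=> eps0 nb; apply: contrapT => H; apply: nb; exists eps => // n.
apply: contrapT => H'; apply: H; exists n => N nN; rewrite ltNge; apply/negP => le.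
by apply: H'; exists N.
Qed.

Variable q : R.
Hypothesis q01 : 0 < q < 1.

Let q01' : 0 <= q <= 1. Proof. by case/andP: q01 => *; rewrite !ltW. Qed.

Lemma arm_depends_box n N e A : depends_on (box_seq N) (arm n N e A).
Proof. by apply: depends_sub (@arm_depends n N e A) => v; rewrite mem_filter => /andP[]. Qed.

Lemma prob_negb N f : depends_on (box_seq N) f ->
  prob q N (fun w => f (negb \o w)) = prob (1 - q) N f.
Proof.
move=> df; rewrite /prob (@expect_push _ _ _ _ _ (coin (1 - q)) negb) => [|[]].
- by apply: (@eq_expect _ _ _ _ _ (box_seq N)) => // v ->.
- by rewrite big_mkcond big_bool /= add0r.
- by rewrite big_mkcond big_bool /= addr0 subKr.
Qed.

Lemma prob1 N : prob q N (fun=> 1) = 1.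
Proof. by rewrite /prob (expect_cst (coin_sum1 q)). Qed.

Lemma prob_le N f g : (forall w, f w <= g w) -> prob q N f <= prob q N g.
Proof. exact: (expect_le (coin_ge0 q01')). Qed.

Lemma prob_add N f g : prob q N (fun w => f w + g w) = prob q N f + prob q N g.
Proof. exact: expect_add. Qed.

(** Union bound: each of the six arms fails with probability below 1/12. White arms are black arms
    for the parameter [1 - q]. *)
Lemma prob_arms6 n N : (forall g, prob q N (fun w => ind (~ arm n N nn (half_side N g) w)) < 12%:R^-1) ->
  (forall g, prob (1 - q) N (fun w => ind (~ arm n N star (half_side N g) w)) < 12%:R^-1) ->
  2%:R^-1 <= prob q N (fun w => ind (arms6 n N w)).
Proof.
move=> hb hw.
have {}hw g : prob q N (fun w => ind (~ arm n N star (half_side N g) (negb \o w))) < 12%:R^-1.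
  rewrite (prob_negb (f := fun w => ind (~ arm n N star (half_side N g) w))) //.
  by apply: ind_depends => w w' ww'; rewrite (arm_depends_box n star _ ww').
pose F e A (w : site -> bool) : R := ind (~ arm n N e A w).
have bound w : 1 <= ind (arms6 n N w) + (F nn (left_low N) w + (F nn (top_left N) w +
   (F nn (right_up N) w + (F star (left_up N) (negb \o w) +
   (F star (top_right N) (negb \o w) + F star (bottom_left N) (negb \o w)))))).
  have [a|na] := pselect (arms6 n N w).
    by rewrite (indT _ a) lerDl !addr_ge0 // ind_ge0.
  rewrite indF // add0r /F.
  have ind1 P : ~ P -> 1 <= ind (~ P) :> R by move=> np; rewrite indT.
  have g0 P : 0 <= ind P :> R by exact: ind_ge0.
  have [a1|/ind1 h] := pselect (arm n N nn (left_low N) w); last first.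
    by apply: le_trans h _; rewrite lerDl !addr_ge0.
  rewrite -[leLHS]add0r; apply: lerD => //.
  have [a2|/ind1 h] := pselect (arm n N nn (top_left N) w); last first.
    by apply: le_trans h _; rewrite lerDl !addr_ge0.
  rewrite -[leLHS]add0r; apply: lerD => //.
  have [a3|/ind1 h] := pselect (arm n N nn (right_up N) w); last first.
    by apply: le_trans h _; rewrite lerDl !addr_ge0.
  rewrite -[leLHS]add0r; apply: lerD => //.
  have [a4|/ind1 h] := pselect (arm n N star (left_up N) (negb \o w)); last first.
    by apply: le_trans h _; rewrite lerDl !addr_ge0.
  rewrite -[leLHS]add0r; apply: lerD => //.
  have [a5|/ind1 h] := pselect (arm n N star (top_right N) (negb \o w)); last first.
    by apply: le_trans h _; rewrite lerDl.
  rewrite -[leLHS]add0r; apply: lerD => //.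
  have [a6|/ind1 //] := pselect (arm n N star (bottom_left N) (negb \o w)).
  by case: na.
have := prob_le N bound; rewrite !prob_add prob1.
have E e A g : A =1 half_side N g -> F e A = F e (half_side N g).
  by move=> AE; apply: funext => w; rewrite /F (eq_arm n N e w AE).
rewrite (E _ _ _ (left_lowE N)) (E _ _ _ (top_leftE N)) (E _ _ _ (right_upE N)).
rewrite (E _ _ _ (left_upE N)) (E _ _ _ (top_rightE N)) (E _ _ _ (bottom_leftE N)).
have := hb (true, true, true); have := hb (false, true, false); have := hb (true, false, false).
have := hw (true, false, true); have := hw (false, false, false); have := hw (false, true, true).
rewrite /F.
set x1 := prob _ _ _; set x2 := prob _ _ _; set x3 := prob _ _ _; set x4 := prob _ _ _.
set x5 := prob _ _ _; set x6 := prob _ _ _; set x7 := prob _ _ _.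
have -> : 12%:R^-1 = 1 / 12 :> R by rewrite mul1r.
have -> : 2%:R^-1 = 1 / 2 :> R by rewrite mul1r.
lra.
Qed.

End Dichotomy.

Section DichotomyProof.
Variables (R : archiRealFieldType) (q : R).
Hypothesis q01 : 0 < q < 1.

Let q01' : 0 <= q <= 1. Proof. by case/andP: q01 => *; rewrite !ltW. Qed.

Lemma arms6_depends n N : depends_on [seq v <- box_seq N | annulus n N v] (arms6 n N).
Proof.
move=> w w' ww'; rewrite /arms6; congr [/\ _, _, _ & [/\ _, _ & _]];
  by apply: arm_depends => v vS /=; rewrite ww'.
Qed.

Lemma cut_box_depends n N : (n < N)%N -> depends_on (box_seq N) (cut_box n N).
Proof.
move=> nN w w' ww'; rewrite /cut_box (arms6_depends (n := n) (N := N) (w := w) (w' := w')); last first.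
  by move=> v; rewrite mem_filter => /andP[_]; exact: ww'.
have nsubN v : in_box n v -> v \in box_seq N.
  by rewrite mem_box_seq; case: v => a b; rewrite /in_box /=; move: nN; clear; lia.
congr (_ /\ _); apply/propext; split=> H v bv.
  by rewrite -ww' ?nsubN //; exact: H.
by rewrite ww' ?nsubN //; exact: H.
Qed.

(** The arms depend on the annulus and the recolouring on the inner box, which are disjoint. Making
    the box black therefore costs a factor that does not depend on [N]. *)
Lemma prob_cut_box n N : (n < N)%N ->
  q ^+ size (box_seq n) * prob q N (fun w => ind (arms6 n N w)) <=
  prob q N (fun w => ind (cut_box n N w)).
Proof.
move=> nN; have s1 := coin_sum1 q; have c0 := coin_ge0 q01'.
set A := [seq v <- box_seq N | annulus n N v].
have uA : uniq A by rewrite filter_uniq ?box_seq_uniq.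
have AN : {subset A <= box_seq N} by move=> v; rewrite mem_filter => /andP[].
have dA : depends_on A (fun w => ind (arms6 n N w) : R) by exact/ind_depends/arms6_depends.
have dB : depends_on (box_seq n) (fun w : site -> bool => ind (forall v, in_box n v -> w v) : R).
  apply: ind_depends => w w' ww'; apply/propext; split=> H v bv.
    by rewrite -ww' ?mem_box_seq //; exact: H.
  by rewrite ww' ?mem_box_seq //; exact: H.
have BA : {in box_seq n, forall v, v \notin A}.
  by move=> v; rewrite mem_box_seq mem_filter /annulus => ->; rewrite andbF.
rewrite /prob (expect_sub s1 _ uA (box_seq_uniq N) AN dA).
rewrite (@expect_perm _ _ _ _ (box_seq N) (box_seq n ++ A)); last first.
  apply: uniq_perm; rewrite ?box_seq_uniq //.
    rewrite cat_uniq box_seq_uniq uA andbT; apply/hasPn => v vA; apply/negP => /BA.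
    by rewrite vA.
  move=> v; rewrite mem_box_seq [RHS]mem_cat [v \in A]mem_filter !mem_box_seq /annulus.
  by case: v => a b; rewrite /in_box /=; move: nN; clear; lia.
rewrite [leRHS](@expect_ext _ _ _ _ _ _
    (fun w : site -> bool => ind (forall v, in_box n v -> w v) * ind (arms6 n N w))).
  rewrite [leRHS](expect_indep _ _ dB dA BA); apply: ler_wpM2r.
    by apply: expect_ge0 => // w; exact: ind_ge0.
  apply: expect_coin_ge => // w wb.
  by rewrite indT // => v bv; apply: wb; rewrite mem_box_seq.
move=> w; rewrite /cut_box; have [b|nb] := pselect (forall v, in_box n v -> w v); last first.
  by rewrite (indF _ nb) mul0r indF // => -[].
rewrite (indT _ b) mul1r; congr ind; apply/propext; by split=> [[]|].
Qed.

Lemma prob_shift n N L z : (n < N)%N -> (`|z.1| + N <= L)%N -> (`|z.2| + N <= L)%N ->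
  expect (coin q) (box_seq L) (fun w => ind (cut_box n N (w \o shift z))) xpred0 =
  prob q N (fun w => ind (cut_box n N w)).
Proof.
move=> nN z1 z2; have inj := can_inj (shiftK z).
rewrite (@expect_sub _ _ _ _ (coin_sum1 q) (map (shift z) (box_seq N))).
- by rewrite (expect_map (coin q) (box_seq N) (fun w => ind (cut_box n N w)) _ inj).
- by rewrite map_inj_uniq ?box_seq_uniq.
- exact: box_seq_uniq.
- move=> v /mapP[u + ->]; rewrite !mem_box_seq; move: z1 z2; case: (z) (u) => a b [c d].
  by rewrite /in_box /shift /=; clear; lia.
apply: ind_depends => w w' ww'; apply: cut_box_depends => // v vN.
by apply: ww'; exact: map_f.
Qed.

Lemma expect_ind_count (I : Type) (Z : seq I) (P : I -> Prop) :
  \sum_(z <- Z) ind (P z) = (size [seq z <- Z | `[< P z >]])%:R :> R.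
Proof.
elim: Z => [|z Z IH]; first by rewrite big_nil.
rewrite big_cons IH /= /ind; case: asbool => /=; last by rewrite add0r.
by rewrite -natrD.
Qed.

(** With M = K (2 n + 1), K^2 disjoint translates of the box lie in the box of radius M, and at most
    4 (2 M + 1) <= 12 M of them are cut boxes. Taking expectations and dividing by K gives the
    bound. *)
Lemma prob_cut_box_le n K : (0 < K)%N ->
  prob q (2 * (K * (2 * n).+1)) (fun w => ind (cut_box n (2 * (K * (2 * n).+1)) w)) * K%:R
    <= 12%:R * (2 * n).+1%:R.
Proof.
move=> K0; set M := (K * (2 * n).+1)%N; set N := (2 * M)%N; set c := prob _ _ _.
have nM : (2 * n < M)%N by rewrite /M; move: K0; clear; nia.
have nN : (n < N)%N by rewrite /N; move: nM; clear; lia.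
(* The step [2 * n + 1] of the grid is the width of a box of radius [n], so the boxes about its
   points are disjoint. *)
pose Z : seq site := [seq ((i * (2 * n).+1)%:Z, (j * (2 * n).+1)%:Z) | i <- iota 0 K, j <- iota 0 K].
have inj (i j : nat) : (i * (2 * n).+1)%:Z = (j * (2 * n).+1)%:Z -> i = j.
  by move=> [] /eqP; rewrite eqn_pmul2r // => /eqP.
have uZ : uniq Z.
  apply: allpairs_uniq; [exact: iota_uniq|exact: iota_uniq|].
  by move=> [a b] [a' b'] _ _ /= E; rewrite (inj a a' (congr1 fst E)) (inj b b' (congr1 snd E)).
have ZP z : z \in Z -> exists i j, [/\ (i < K)%N, (j < K)%N &
    z = ((i * (2 * n).+1)%:Z, (j * (2 * n).+1)%:Z)].
  move=> /allpairsP[[i j] /= [+ + ->]]; rewrite !mem_iota /= !add0n => iK jK.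
  by exists i, j.
have ZM : {in Z, forall z, (`|z.1| + n < M)%N && (`|z.2| + n < M)%N}.
  move=> z /ZP[i [j [iK jK ->]]] /=.
  have H k : (k < K)%N -> (k * (2 * n).+1 + n < M)%N by rewrite /M; clear; nia.
  by rewrite !H.
have ZI : {in Z &, forall z z' v, in_box n (unshift z v) -> in_box n (unshift z' v) -> z = z'}.
  have H (i j : nat) (a : int) : (`|(a - (i * (2 * n).+1)%:Z)%R| <= n)%N ->
      (`|(a - (j * (2 * n).+1)%:Z)%R| <= n)%N -> i = j.
    clear; wlog ij : i j / (i <= j)%N => [W hi hj|hi hj].
      by have [ij|/ltnW ji] := leqP i j; [exact: W|apply/esym; exact: W].
    apply/eqP; rewrite eqn_leq ij /= leqNgt; apply/negP => lt_ij.
    have : (i.+1 * (2 * n).+1 <= j * (2 * n).+1)%N by rewrite leq_mul2r lt_ij orbT.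
    rewrite mulSn; move: hi hj; move: (i * _)%N (j * _)%N => x y; clear; lia.
  move=> z z' /ZP[i [j [_ _ ->]]] /ZP[i' [j' [_ _ ->]]] v.
  rewrite /in_box /unshift /= => /andP[h1 h2] /andP[h3 h4].
  by rewrite (H _ _ _ h1 h3) (H _ _ _ h2 h4).
have szZ : size Z = (K * K)%N by rewrite size_allpairs !size_iota.
have : expect (coin q) (box_seq (M + N)) (fun w => \sum_(z <- Z) ind (cut_box n N (w \o shift z))) xpred0
    <= (4 * (2 * M).+1)%:R.
  rewrite -[leRHS](expect_cst (coin_sum1 q) (box_seq (M + N)) _ xpred0).
  apply: (expect_le (coin_ge0 q01')) => w; rewrite expect_ind_count ler_nat.
  exact: cut_box_count.
rewrite (expect_sum (coin_sum1 q)) (eq_big_seq (fun=> c)) => [|z zZ]; last first.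
  have /andP[z1 z2] := ZM z zZ.
  by apply: prob_shift => //; move: z1 z2; clear; lia.
rewrite big_const_seq count_predT iter_addr_0 szZ -[c *+ _]mulr_natr => le1.
have Kp : 0 < K%:R :> R by rewrite ltr0n.
rewrite -(ler_pM2r Kp) (_ : c * K%:R * K%:R = c * (K * K)%:R); last by rewrite natrM mulrA.
apply: le_trans le1 _.
by rewrite -!natrM ler_nat /M; move: K0; clear; nia.
Qed.

(** Otherwise the probability of a cut box is bounded below uniformly in the outer radius, while by
    counting it is at most of order 1/K. *)
Theorem blockable_dichotomy : blockable nn q \/ blockable star (1 - q).
Proof.
apply: contrapT => /not_orP[nb1 nb2].
have eta0 : 0 < 12%:R^-1 :> R by rewrite invr_gt0.
(* The square root trick loses an eighth power, and [prob_arms6] allows each arm to fail with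
   probability up to 1/12. *)
have e8 : 0 < (12%:R^-1 : R) ^+ 8 by exact: exprn_gt0.
have [n1 h1] := not_blockable e8 nb1; have [n2 h2] := not_blockable e8 nb2.
pose n := maxn n1 n2.
have p01' : 0 <= 1 - q <= 1 by have := q01'; move=> /andP[*]; lra.
have shrink (p : R) e m : 0 <= p <= 1 -> (m <= n)%N ->
    (forall N, (m < N)%N -> prob p N (fun w => ind (~ crossing m N e w)) < 12%:R^-1 ^+ 8) ->
    forall N, (n < N)%N -> prob p N (fun w => ind (~ crossing n N e w)) < 12%:R^-1 ^+ 8.
  move=> p01 mn hm N nN; apply: le_lt_trans (hm N (leq_ltn_trans mn nN)).
  apply: (expect_le (coin_ge0 p01)) => w; apply: ind_le; apply: contra_not.
  by apply: crossing_shrink; rewrite mn.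
have {}h1 := shrink _ _ _ q01' (leq_maxl _ _) h1.
have {}h2 := shrink _ _ _ p01' (leq_maxr _ _) h2.
pose c : R := q ^+ size (box_seq n) * 2%:R^-1.
have c0 : 0 < c by rewrite mulr_gt0 ?invr_gt0 // exprn_gt0 //; case/andP: q01.
have low N : (n < N)%N -> c <= prob q N (fun w => ind (cut_box n N w)).
  move=> nN; apply: le_trans (prob_cut_box nN); apply: ler_wpM2l.
    by rewrite exprn_ge0 //; case/andP: q01'.
  apply: prob_arms6 => // g.
    by apply: (square_root_trick q01' dihedral_nn g (ltW eta0)); exact: h1.
  by apply: (square_root_trick p01' dihedral_star g (ltW eta0)); exact: h2.
(* [K] is large enough for c K to exceed the upper bound 12 (2 n + 1). *)
pose K := (Num.bound (12%:R * (2 * n).+1%:R / c)).+1.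
have K0 : (0 < K)%N by [].
have nN : (n < 2 * (K * (2 * n).+1))%N by move: K0; clear; nia.
have := prob_cut_box_le n K0; apply/negP; rewrite -ltNge.
have Kp : 0 < K%:R :> R by rewrite ltr0n.
apply: lt_le_trans (ler_wpM2r (ltW Kp) (low _ nN)).
rewrite -ltr_pdivrMl // [ltLHS]mulrC; apply: lt_le_trans (archi_boundP _) _.
  by apply: divr_ge0 (ltW c0); apply: mulr_ge0; exact: ler0n.
by rewrite ler_nat.
Qed.

End DichotomyProof.

(** * Independent uniform labels *)

Section Digits.
Variables (R : realType) (k : nat).
Local Notation b := k.+1.
Local Notation St := 'I_b.
Local Notation P := (uniform_prob (@ltr01 R)).

(* The labels are the base-b digits of a uniform random number in [0, 1]. *)
Definition code (n : nat) (u : R) : nat := Num.truncn (b%:R ^+ n * u).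

Definition digits (u : R) (i : nat) : St := inord (code i.+1 u %% b).

Definition code_digits (n j i : nat) : St := inord (j %/ b ^ (n - i.+1) %% b).

Definition uniform_law (s : St) : R := b%:R^-1.

Lemma uniform_law_ge0 s : 0 <= uniform_law s. Proof. by rewrite invr_ge0. Qed.

Lemma uniform_law_sum1 : \sum_s uniform_law s = 1.
Proof.
by rewrite sumr_const card_ord -[_ *+ _]mulr_natr mulVf // pnatr_eq0.
Qed.

(** [Num.truncn] is zero on negative numbers, so the identity holds on the whole line, and digits
    are read off from [code] at every real number. *)
Lemma truncn_div (x : R) (m : nat) : (0 < m)%N -> Num.truncn (x / m%:R) = (Num.truncn x %/ m)%N.
Proof.
move=> m0; have mp : 0 < m%:R :> R by rewrite ltr0n.
have [x0|x0] := leP 0 x; last first.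
  have T0 (y : R) : y < 0 -> Num.truncn y = 0%N.
    by move=> y0; apply/eqP; rewrite -leqn0 truncn_le_nat (lt_trans y0).
  by rewrite !T0 ?div0n // pmulr_llt0 // invr_gt0.
have /andP[h1 h2] := truncn_itv x0.
apply: truncn_def; apply/andP; split.
  rewrite ler_pdivlMr // -natrM; apply: le_trans h1; rewrite ler_nat.
  exact: leq_trunc_div.
rewrite ltr_pdivrMr // -natrM; apply: lt_le_trans h2 _; rewrite ler_nat.
by rewrite ltn_ceil.
Qed.

Lemma digits_code n u i : (i < n)%N -> digits u i = code_digits n (code n u) i.
Proof.
move=> i_n; rewrite /digits /code_digits; congr (inord (_ %% _)).
have bp : b%:R != 0 :> R by rewrite pnatr_eq0.
rewrite /code -truncn_div ?expn_gt0 //; congr Num.truncn.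
have -> : b%:R ^+ n = b%:R ^+ i.+1 * b%:R ^+ (n - i.+1) :> R by rewrite -exprD subnKC.
by rewrite natrX mulrAC mulfK // expf_neq0.
Qed.

(** Words of [n] digits are the numbers below b^n; the induction splits off the last digit, as in s
    + j b. *)
Lemma expect_code n f w : depends_on (iota 0 n) f ->
  expect uniform_law (iota 0 n) f w =
  \sum_(0 <= j < b ^ n) (b ^ n)%:R^-1 * f (code_digits n j).
Proof.
elim: n f => [|n IH] f df.
  rewrite expn0 big_nat1 invr1 mul1r /=; exact: df.
have -> : iota 0 n.+1 = iota 0 n ++ [:: n] by rewrite -addn1 iotaD.
rewrite expect_cat IH; last first.
  move=> w1 w2 w12; apply: (@eq_expect _ _ _ _ [:: n] (iota 0 n.+1)) => // v.
  rewrite mem_iota inE => /= vn vn'; apply: w12; rewrite mem_iota /=.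
  by move: vn vn'; clear; lia.
rewrite expnSr big_nat_mul; apply: eq_bigr => j _ /=.
rewrite -[X in _ = \sum_(X <= _ < _) _]add0n big_addn mulSn addnK big_mkord mulr_sumr.
apply: eq_bigr => s _; rewrite mulrA natrM invfM; congr (_ * _).
apply: df => i; rewrite mem_iota /= add0n ltnS => i_n.
rewrite /upd /code_digits; case: eqVneq => [->|ni].
  rewrite subnn expn0 divn1 addnC modnMDl modn_small //.
  by rewrite inord_val.
have {}i_n : (i < n)%N by rewrite ltn_neqAle ni.
rewrite subSS; have -> : (n - i = (n - i.+1).+1)%N by rewrite subnSK.
have sj : ((s + j * b) %/ b = j)%N by rewrite addnC divnMDl // divn_small // addn0.
by rewrite expnS divnMA sj.
Qed.

Lemma measurable_code n (G : set nat) : measurable (code n @^-1` G : set R).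
Proof.
have -> : code n @^-1` G = \bigcup_j (if `[< G j >] then [set u : R | code n u = j] else set0).
  apply/seteqP; split => u /=.
    by move=> Gu; exists (code n u) => //=; rewrite asboolT.
  by move=> [j _]; case: asboolP => // Gj /= ->.
apply: bigcupT_measurable => j; case: asbool => //.
have bp : 0 < b%:R ^+ n :> R by rewrite exprn_gt0 // ltr0n.
have lt_code m : [set u | (code n u < m.+1)%N] = `]-oo, (m.+1%:R / b%:R ^+ n)[%classic :> set R.
  apply/seteqP; split => u /=; rewrite in_itv /= /code ltnS truncn_le_nat ltr_pdivlMr // mulrC //.
have -> : [set u | code n u = j] = [set u | (code n u < j.+1)%N] `\` [set u | (code n u < j)%N].
  apply/seteqP; split => u /=; first by move=> ->; rewrite ltnSn ltnn.
  by rewrite ltnS => -[cj /negP]; rewrite -leqNgt => jc; apply/eqP; rewrite eqn_leq cj.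
apply: measurableD; first by rewrite lt_code; exact: measurable_itv.
by case: j => [|j]; [rewrite (_ : [set _ | _] = set0) //; apply/seteqP; split|rewrite lt_code; exact: measurable_itv].
Qed.

Lemma prob_code n j : (j < b ^ n)%N -> P [set u | code n u = j] = ((b ^ n)%:R^-1)%:E.
Proof.
move=> jb; have bp : 0 < (b ^ n)%:R :> R by rewrite ltr0n expn_gt0.
rewrite /uniform_prob integral_uniform_pdf.
have E : [set u | code n u = j] `&` `[0, 1] =
    `[j%:R / (b ^ n)%:R, j.+1%:R / (b ^ n)%:R[%classic :> set R.
  apply/seteqP; split => u /=; rewrite !in_itv /= /code -natrX.
    move=> [cj /andP[u0 u1]]; move/eqP: cj; rewrite truncn_eq ?mulr_ge0 //.
    by rewrite ler_pdivrMr // ltr_pdivlMr // [u * _]mulrC.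
  rewrite ler_pdivrMr // ltr_pdivlMr // [u * _]mulrC => /andP[h1 h2].
  have u0 : 0 <= u by rewrite -(pmulr_rge0 _ bp); exact: le_trans h1.
  split; first by apply/eqP; rewrite truncn_eq ?mulr_ge0 // h1.
  rewrite u0 -(ler_pM2l bp) mulr1 ltW // (lt_le_trans h2) //.
  by rewrite ler_nat.
rewrite E (eq_integral (fun=> 1%:E)) => [|x]; last first.
  rewrite inE -E => -[_] /=; rewrite in_itv /= /uniform_pdf => ->.
  by rewrite subr0 invr1.
rewrite integral_cst //= mul1e lebesgue_measure_itv /= lte_fin ltr_pM2r ?invr_gt0 //.
by rewrite ltr_nat ltnSn -EFinB -mulrBl -natrB // subSnn mul1r.
Qed.

Lemma prob_code_ge n (G : set nat) :
  ((\sum_(0 <= j < b ^ n) (b ^ n)%:R^-1 * ind (G j))%:E <= P (code n @^-1` G))%E.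
Proof.
pose F j : set R := if `[< G j >] && (j < b ^ n)%N then [set u | code n u = j] else set0.
have mF j : measurable (F j).
  by rewrite /F; case: ifP => // _; exact: (measurable_code n [set j]).
have tF : trivIset setT F.
  apply/trivIsetP => i j _ _ ij; rewrite /F; case: ifP => _; last by rewrite set0I.
  case: ifP => _; last by rewrite setI0.
  by apply/seteqP; split => u //= [-> /eqP]; rewrite (negbTE ij).
have -> : ((\sum_(0 <= j < b ^ n) (b ^ n)%:R^-1 * ind (G j))%:E =
    P (\big[setU/set0]_(j < b ^ n) F j))%E.
  rewrite measure_bigsetU // big_mkord -sumEFin; apply: eq_bigr => j _.
  rewrite /F ltn_ord andbT /ind; case: asboolP => Gj /=.
    by rewrite mulr1 prob_code.
  by rewrite mulr0 measure0.
apply: le_measure; rewrite ?inE.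
- by apply: bigsetU_measurable => j _; exact: mF.
- exact: measurable_code.
move=> u; rewrite -bigcup_mkord => -[j _]; rewrite /F; case: ifP => //.
by move=> /andP[/asboolP Gj _] /= ->.
Qed.

(** The lower bounds for [G] and for its complement add up to one, so both are equalities. Codes
    outside the range, which occur for numbers outside [0, 1), need no separate treatment. *)
Lemma prob_code_set n (G : set nat) :
  P (code n @^-1` G) = (\sum_(0 <= j < b ^ n) (b ^ n)%:R^-1 * ind (G j))%:E.
Proof.
have S1 : \sum_(0 <= j < b ^ n) (b ^ n)%:R^-1 = 1 :> R.
  by rewrite big_const_nat subn0 iter_addr_0 -[_ *+ _]mulr_natr mulVf // pnatr_eq0 expn_eq0.
have mG := measurable_code n G.
have [r Pr] : exists r, P (code n @^-1` G) = r%:E.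
  by exists (fine (P (code n @^-1` G))); rewrite fineK // fin_num_measure.
have h1 : ((\sum_(0 <= j < b ^ n) (b ^ n)%:R^-1 * ind (G j))%:E <= r%:E)%E.
  by rewrite -Pr; exact: prob_code_ge.
have h2 : ((\sum_(0 <= j < b ^ n) (b ^ n)%:R^-1 * ind ((~` G) j))%:E <= 1 - r%:E)%E.
  by rewrite -Pr -probability_setC //; exact: prob_code_ge.
rewrite [LHS]Pr; congr EFin; apply/eqP; rewrite eq_le; apply/andP; split; last first.
  by rewrite -lee_fin.
move: h2; rewrite -EFinB lee_fin.
have -> : \sum_(0 <= j < b ^ n) (b ^ n)%:R^-1 * ind ((~` G) j) =
    1 - \sum_(0 <= j < b ^ n) (b ^ n)%:R^-1 * ind (G j) :> R.
  rewrite -[X in _ = X - _]S1 -sumrB; apply: eq_bigr => j _.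
  by rewrite -[(~` G) j]/(~ G j) indN mulrBr mulr1.
by clear; lra.
Qed.

Lemma prob_digits n (F : (nat -> St) -> Prop) w : depends_on (iota 0 n) F ->
  measurable [set u | F (digits u)] /\
  P [set u | F (digits u)] = (expect uniform_law (iota 0 n) (fun w => ind (F w)) w)%:E.
Proof.
move=> dF; have E : [set u | F (digits u)] = code n @^-1` [set j | F (code_digits n j)].
  apply/seteqP; split => u /=; rewrite (dF (digits u) (code_digits n (code n u))) // => i;
    by rewrite mem_iota /= => i_n; exact: digits_code.
rewrite E; split; first exact: measurable_code.
by rewrite prob_code_set expect_code //; exact: ind_depends.
Qed.

End Digits.

(** * Models that are functions of independent labels *)

Section BlockFactor.
Variables (R : realType) (k : nat).
Local Notation St := 'I_k.+1.
Local Notation P := (uniform_prob (@ltr01 R)).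
Local Notation G := (Z2 R).
Local Notation E := (expect (@uniform_law R k)).

Definition config (u : R) (v : site) : St := digits k u (pickle v).

Lemma prob_config (S : seq site) (F : (site -> St) -> Prop) w : uniq S -> depends_on S F ->
  measurable [set u : R | F (config u)] /\
  P [set u | F (config u)] = (E S (fun w => ind (F w)) w)%:E.
Proof.
move=> uS dF; pose F' (d : nat -> St) := F (d \o pickle).
have inj : injective (pickle : site -> nat) := pcan_inj pickleK.
have dS : depends_on (map pickle S) F'.
  by move=> d d' dd'; apply: dF => v vS /=; apply: dd'; exact: map_f.
pose n := (\max_(v <- S) pickle v).+1.
have Sn : {subset map pickle S <= iota 0 n}.
  move=> i /mapP[v vS ->]; rewrite mem_iota /= add0n ltnS.
  by rewrite (big_rem v vS) /= leq_maxl.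
have uS' : uniq (map pickle S) by rewrite map_inj_uniq.
have dn : depends_on (iota 0 n) F' by exact: depends_sub dS.
have [mF ->] := prob_digits R (fun=> ord0) dn; split => //.
congr EFin; rewrite (expect_sub (@uniform_law_sum1 R k) _ uS' (iota_uniq 0 n) Sn); last exact: ind_depends.
rewrite (expect_map _ S (fun w => ind (F w) : R) _ inj).
by apply: (@eq_expect _ _ _ _ _ S); [exact: ind_depends|move=> v ->].
Qed.

Variable rho : site -> site -> St -> St -> bool.
Hypothesis rho_sym : forall x y s t, rho x y s t = rho y x t s.

Definition open_set (w : site -> St) : spanning_subgraph G :=
  [set e | exists x y : site, [/\ @adj G x y, sval e = [set x; y] & rho x y (w x) (w y)]].

Lemma pair_set_eq (T : Type) (x y x' y' : T) : [set x; y] = [set x'; y'] ->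
  (x = x' /\ y = y') \/ (x = y' /\ y = x').
Proof.
move=> /seteqP[s1 s2].
have := s1 x (or_introl erefl); have := s1 y (or_intror erefl).
have := s2 x' (or_introl erefl); have := s2 y' (or_intror erefl).
move=> /= [] h1 [] h2 [] h3 [] h4; subst; auto.
Qed.

Lemma open_setE (e : edge G) (x y : site) w : @adj G x y -> sval e = [set x; y] ->
  open_set w e = rho x y (w x) (w y).
Proof.
move=> xy exy; apply/propext; split => [[x' [y' [_ e' r]]]|r]; last by exists x, y.
have [[-> ->] //|[-> ->]] := pair_set_eq (etrans (esym exy) e').
by rewrite rho_sym.
Qed.

Lemma edge_ends (e : edge G) : exists x y : site,
  [/\ @adj G x y, sval e = [set x; y] & (x != y)].
Proof.
case: e => e [x [y [xy exy]]]; exists x, y; split => //.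
by apply: contraTneq xy => ->; rewrite adj_irr.
Qed.

(** Only open edges are prescribed: such events are closed under intersection, by concatenation of
    lists, and generate the sigma-algebra. *)
Definition cylinder (l : seq (edge G)) : set (spanning_subgraph G) :=
  [set w | forall e, List.In e l -> w e].

Lemma cylinder_depends (l : seq (edge G)) : exists S : seq site,
  [/\ uniq S, forall v, v \in S -> exists2 e, List.In e l & sval e v &
      depends_on S (fun w => cylinder l (open_set w))].
Proof.
elim: l => [|e l [S [uS Sl dS]]].
  by exists [::]; split => // w w' _; apply/propext; split=> _ e [].
have [x [y [xy exy _]]] := edge_ends e.
exists (undup [:: x, y & S]); split; first exact: undup_uniq.
  move=> v; rewrite mem_undup !inE => /or3P[/eqP ->|/eqP ->|vS].
  - by exists e; [left|rewrite exy; left].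
  - by exists e; [left|rewrite exy; right].
  - by have [f fl fv] := Sl v vS; exists f => //; right.
move=> w w' ww'.
have {}ww' v : v \in [:: x, y & S] -> w v = w' v by move=> vS; apply: ww'; rewrite mem_undup.
have dl : cylinder l (open_set w) = cylinder l (open_set w').
  by apply: dS => v vS; apply: ww'; rewrite !inE vS !orbT.
have ef : open_set w e = open_set w' e.
  by rewrite !(open_setE _ xy exy) !ww' ?inE ?eqxx ?orbT.
have cons w0 : cylinder (e :: l) (open_set w0) = (open_set w0 e /\ cylinder l (open_set w0)).
  apply/propext; split => [H|[H1 H2] f /= [<-|]] //; last exact: H2.
  by split => [|f fl]; apply: H; [left|right].
by rewrite !cons ef dl.
Qed.

Definition random_subgraph (u : measurableTypeR R) : percolation_space G := open_set (config u).

Lemma measurable_random_subgraph : measurable_fun setT random_subgraph.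
Proof.
apply: (@measurability _ _ _ (percolation_space G) setT random_subgraph (edge_events [set: edge G]) erefl) => _ [_ [e _ <-] <-].
rewrite setTI.
have [S [uS _ dS]] := cylinder_depends [:: e].
have [mS _] := prob_config (fun=> ord0) uS dS.
rewrite (_ : _ @^-1` _ = [set u | cylinder [:: e] (open_set (config u))]) //.
apply/seteqP; split => u /= H; first by move=> f [<-|[]].
by apply: H; left.
Qed.

HB.instance Definition _ := isMeasurableFun.Build _ _ _ _ random_subgraph
  measurable_random_subgraph.

Definition model : percolation_model R G := distribution P random_subgraph.

Lemma measurable_cylinder l : measurable (cylinder l : set (percolation_space G)).
Proof.
elim: l => [|e l IH].
  by rewrite (_ : cylinder [::] = setT) //; apply/seteqP; split => // w _ e [].
rewrite (_ : cylinder (e :: l) = is_open e `&` cylinder l).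
  by apply: measurableI => //; apply: sub_sigma_algebra; exists e.
apply/seteqP; split => w /= H.
  by split => [|f fl]; apply: H; [left|right].
by case: H => H1 H2 f [<-|] //; exact: H2.
Qed.

Lemma model_cylinderI l l' :
  (forall e f, List.In e l -> List.In f l' -> ~ share_vertex e f) ->
  (model (cylinder l `&` cylinder l') = model (cylinder l) * model (cylinder l'))%E.
Proof.
move=> ll'; have [S [uS Sl dS]] := cylinder_depends l.
have [S' [uS' Sl' dS']] := cylinder_depends l'.
have disj : {in S, forall v, v \notin S'}.
  move=> v /Sl[e el ev]; apply/negP => /Sl'[f fl fv].
  by apply: (ll' e f) => //; exists v.
have uSS : uniq (S ++ S').
  rewrite cat_uniq uS uS' andbT; apply/hasPn => v vS'; apply/negP => /disj.
  by rewrite vS'.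
have dSS : depends_on (S ++ S') (fun w => cylinder l (open_set w) /\ cylinder l' (open_set w)).
  move=> w w' ww'; congr (_ /\ _).
    by apply: dS => v vS; apply: ww'; rewrite mem_cat vS.
  by apply: dS' => v vS; apply: ww'; rewrite mem_cat vS orbT.
have [_ E1] := prob_config (fun=> ord0) uS dS.
have [_ E2] := prob_config (fun=> ord0) uS' dS'.
have [_ E3] := prob_config (fun=> ord0) uSS dSS.
transitivity (P [set u | cylinder l (open_set (config u)) /\ cylinder l' (open_set (config u))]) => //.
transitivity (P [set u | cylinder l (open_set (config u))] *
  P [set u | cylinder l' (open_set (config u))])%E => //.
rewrite E1 E2 E3 -EFinM; congr EFin.
rewrite -(expect_indep _ _ (@ind_depends R _ _ _ _ dS) (@ind_depends R _ _ _ _ dS') disj).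
apply: expect_ext => w; rewrite /ind -natrM mulnb; congr (_%:R).
by rewrite asbool_and.
Qed.

(** Uniqueness of measures on a pi-system: as functions of [A], both sides are finite measures, and
    they agree on cylinders. *)
Lemma model_independent_of S B : measurable (B : set (percolation_space G)) ->
  (forall l, (forall e, List.In e l -> S e) ->
    (model (cylinder l `&` B) = model (cylinder l) * model B)%E) ->
  forall A, sigma_edges S A -> (model (A `&` B) = model A * model B)%E.
Proof.
move=> mB HB A SA.
pose C : set (set (percolation_space G)) :=
  [set A | exists2 l, (forall e, List.In e l -> S e) & A = cylinder l].
have b0 : 0 <= fine (model B) by rewrite fine_ge0.
have mBE : (model B = (fine (model B))%:E)%E by rewrite fineK // fin_num_measure.
(* The cylinder of the empty list is the whole space, so the constant sequence exhausts it. *)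
have := @g_sigma_algebra_measure_unique _ R (percolation_space G) C _ (fun=> cylinder [::]) _ _
  (mrestr model mB) (mscale (NngNum b0) model) _ _ _ A.
move=> H.
have {H}: mrestr model mB A = mscale (NngNum b0) model A.
  apply: H.
  - by move=> _ [l _ ->]; exact: measurable_cylinder.
  - by move=> i; exists [::].
  - by apply/seteqP; split => // w _; exists 0%N => // e [].
  - move=> _ _ [l lS ->] [l' lS' ->]; exists (l ++ l').
      by move=> e el; case: (List.in_app_or _ _ _ el); [exact: lS|exact: lS'].
    apply/seteqP; split => w /=.
      by move=> [H1 H2] e el; case: (List.in_app_or _ _ _ el) => h; [exact: H1|exact: H2].
    by move=> H; split => e el; apply: H; apply: List.in_or_app; [left|right].
  - move=> _ [l lS ->]; apply: etrans (HB l lS) _; rewrite /mscale muleC.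
    by congr (_ * _)%E; exact: mBE.
  - move=> _; rewrite /mrestr; apply: le_lt_trans (probability_le1 _ _) (ltry _).
    by apply: measurableI => //; exact: measurable_cylinder.
  - apply: sub_sigma_algebra2 SA => _ [e Se <-]; exists [:: e].
      by move=> f [<-|[]].
    apply/seteqP; split => w /= H; first by move=> f [<-|[]].
    by apply: H; left.
rewrite /mrestr /mscale => E0; apply: etrans E0 _; rewrite muleC.
by congr (_ * _)%E; exact/esym.
Qed.

Lemma sigma_edges_measurable S A : sigma_edges S A ->
  measurable (A : set (percolation_space G)).
Proof.
by move=> SA; apply: sub_sigma_algebra2 SA => _ [e _ <-]; exists e.
Qed.

(** The passage from cylinders to the sigma-algebra is made twice, once for each of the two events.
    For cylinders, edges without common vertices read disjoint sets of labels. *)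
Lemma model_one_independent : one_independent model.
Proof.
move=> S1 S2 _ S12 A B SA SB.
apply: (model_independent_of (sigma_edges_measurable SB) _ SA) => l lS1.
rewrite setIC muleC.
apply: (model_independent_of (measurable_cylinder l) _ SB) => l' lS2.
apply: model_cylinderI => e f el fl [v [ev fv]].
by apply: (S12 f e (lS1 _ fl) (lS2 _ el)); exists v.
Qed.

Lemma model_is_open (e : edge G) (x y : site) : @adj G x y -> sval e = [set x; y] ->
  (model (is_open e) = (\sum_s \sum_t (k.+1%:R ^- 2 * (rho x y s t)%:R))%:E)%E.
Proof.
move=> xy exy.
have nxy : x != y by apply: contraTneq xy => ->; rewrite adj_irr.
have d : depends_on [:: x; y] (fun w : site -> St => rho x y (w x) (w y) : Prop).
  by move=> w w' ww'; rewrite !ww' ?inE ?eqxx ?orbT.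
have u : uniq [:: x; y] by rewrite /= inE nxy.
have [_] := prob_config (fun=> ord0) u d.
have -> : [set u | is_true (rho x y (config u x) (config u y))] = random_subgraph @^-1` is_open e.
  by apply/seteqP; split => u' /=; rewrite /random_subgraph /is_open /= (open_setE _ xy exy).
move=> E0; rewrite -[LHS]/(P (random_subgraph @^-1` is_open e)) E0; congr EFin.
rewrite /=; apply: eq_bigr => s _; rewrite mulr_sumr; apply: eq_bigr => t _.
rewrite mulrA /uniform_law -expr2 exprVn; congr (_ * _).
by rewrite /upd eqxx (negbTE nxy) eqxx /ind; case: rho; [rewrite asboolT|rewrite asboolF].
Qed.

End BlockFactor.

(** * Measurability of the existence of an infinite component *)

Section InfiniteComponentMeasurable.
Variable G : graph.

Lemma measurable_open_adj (x y : G) :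
  measurable ([set w | open_adj w x y] : set (percolation_space G)).
Proof.
have [[e exy]|ne] := pselect (exists e : edge G, sval e = [set x; y]); last first.
  rewrite (_ : [set w | _] = set0) //; apply/seteqP; split => // w /asboolP[e [_ exy]].
  by apply: ne; exists e.
rewrite (_ : [set w | _] = is_open e); first by apply: sub_sigma_algebra; exists e.
apply/seteqP; split => w; last by move=> we; apply/asboolP; exists e.
move=> /asboolP[f [wf fxy]]; rewrite /is_open /= (_ : e = f) //.
case: e f exy fxy {wf} => a pa [b pb] /= ea eb; subst a b.
by congr exist; exact: Prop_irrelevance.
Qed.

Lemma measurable_open_path (x : G) p :
  measurable ([set w | path (open_adj w) x p] : set (percolation_space G)).
Proof.
elim: p x => [|y p IH] x; first by rewrite (_ : [set w | _] = setT) //; apply/seteqP; split.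
rewrite (_ : [set w | _] = [set w | open_adj w x y] `&` [set w | path (open_adj w) y p]).
  by apply: measurableI => //; exact: measurable_open_adj.
by apply/seteqP; split => w /=; [move/andP|move=> h; apply/andP].
Qed.

Lemma measurable_component (x y : G) :
  measurable ([set w | component w x y] : set (percolation_space G)).
Proof.
rewrite (_ : [set w | _] = \bigcup_(p : seq G)
    (if last x p == y then [set w | path (open_adj w) x p] else set0)).
  apply: countable_bigcupT_measurable; first exact: countableP.
  by move=> p; case: ifP => // _; exact: measurable_open_path.
apply/seteqP; split => w /=; first by move=> [p [ep <-]]; exists p => //=; rewrite eqxx.
by move=> [p _]; case: eqP => // lp ep; exists p.
Qed.

(** Unboundedness in the enumeration of the vertices turns infinitude into countable unions and
    intersections. *)
Lemma infinite_component_pickle (A : set G) :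
  infinite_set A <-> forall n, exists2 y, A y & (n <= pickle y)%N.
Proof.
split => [infA n|H fA].
  apply: contrapT => H; apply: infA.
  apply: (@sub_finite_set _ _ (pickle @^-1` `I_n)).
    by move=> y Ay /=; rewrite ltnNge; apply/negP => ny; apply: H; exists y.
  apply: finite_preimage; last exact: finite_II.
  by move=> y z _ _; exact: (pcan_inj pickleK).
have [n nP] : exists n, forall y, A y -> (pickle y < n)%N.
  have /finite_setP[m Am] := fA; have /finite_seqP[s sA] := fA.
  exists (\max_(y <- s) pickle y).+1 => y; rewrite sA /= => ys.
  by rewrite ltnS (big_rem y ys) /= leq_maxl.
by have [y Ay] := H n; rewrite leqNgt nP.
Qed.

Lemma measurable_has_infinite_component :
  measurable (@has_infinite_component G : set (percolation_space G)).
Proof.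
rewrite (_ : @has_infinite_component G = \bigcup_(x : G) \bigcap_n \bigcup_(y : G)
    (if (n <= pickle y)%N then [set w | component w x y] else set0)).
  apply: countable_bigcupT_measurable; first exact: countableP.
  move=> x; apply: bigcapT_measurable => n.
  apply: countable_bigcupT_measurable; first exact: countableP.
  by move=> y; case: ifP => // _; exact: measurable_component.
apply/seteqP; split => w.
  move=> [x /infinite_component_pickle H]; exists x => // n _.
  by have [y Cy ny] := H n; exists y => //; rewrite ny.
move=> [x _ H]; exists x; apply/infinite_component_pickle => n.
by have [y _] := H n I; case: ifP => // ny Cy; exists y.
Qed.

End InfiniteComponentMeasurable.

(** * Non-percolation from independent necessary events *)

Section NonPercolation.
Variables (R : realType) (k : nat).
Local Notation St := 'I_k.+1.
Local Notation P := (uniform_prob (@ltr01 R)).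
Local Notation G := (Z2 R).
Local Notation E := (expect (@uniform_law R k)).

Variables (S : nat -> seq site) (A : nat -> (site -> St) -> Prop) (eps : R).
Hypothesis uniqS : forall i, uniq (S i).
Hypothesis disjS : forall i j v, v \in S i -> v \in S j -> i = j.
Hypothesis depA : forall i, depends_on (S i) (A i).
Hypothesis eps01 : 0 < eps <= 1.
Hypothesis EA : forall i, E (S i) (fun w => ind (A i w)) (fun=> ord0) <= 1 - eps.

Lemma expect_all_le i0 m : exists T : seq site, [/\ uniq T,
  forall v, v \in T -> exists2 i, (i0 <= i < i0 + m)%N & v \in S i,
  depends_on T (fun w => forall i, (i0 <= i < i0 + m)%N -> A i w) &
  E T (fun w => ind (forall i, (i0 <= i < i0 + m)%N -> A i w)) (fun=> ord0) <= (1 - eps) ^+ m].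
Proof.
elim: m => [|m [T [uT TS dT ET]]].
  exists [::]; split => //; last by rewrite /= expr0 ind_le1.
  move=> w w' _; apply/propext; split => _ i; rewrite addn0 => /andP[h1 h2];
    by move: (leq_ltn_trans h1 h2); rewrite ltnn.
have disj : {in T, forall v, v \notin S (i0 + m)%N}.
  move=> v /TS[i /andP[_ im] vi]; apply/negP => /(disjS vi) E0.
  by rewrite E0 ltnn in im.
have step w : (forall i, (i0 <= i < i0 + m.+1)%N -> A i w) =
    ((forall i, (i0 <= i < i0 + m)%N -> A i w) /\ A (i0 + m)%N w).
  apply/propext; split => [H|[H1 H2] i /andP[i1 i2]].
    split; last by apply: H; rewrite leq_addr addnS ltnSn.
    by move=> i /andP[i1 i2]; apply: H; rewrite i1 addnS ltnS ltnW.
  move: i2; rewrite addnS ltnS leq_eqVlt => /orP[/eqP -> //|i2].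
  by apply: H1; rewrite i1.
exists (T ++ S (i0 + m)%N); split.
- rewrite cat_uniq uT uniqS andbT; apply/hasPn => v vS; apply/negP => /disj.
  by rewrite vS.
- move=> v; rewrite mem_cat => /orP[/TS[i /andP[i1 i2] vi]|vS].
    by exists i => //; rewrite i1 addnS ltnS ltnW.
  by exists (i0 + m)%N => //; rewrite leq_addr addnS ltnSn.
- move=> w w' ww'; rewrite !step; congr (_ /\ _).
    by apply: dT => v vT; apply: ww'; rewrite mem_cat vT.
  by apply: depA => v vT; apply: ww'; rewrite mem_cat vT orbT.
rewrite (@expect_ext _ _ _ _ _ _ (fun w => ind (forall i, (i0 <= i < i0 + m)%N -> A i w) *
    ind (A (i0 + m)%N w))); last first.
  by move=> w; rewrite step /ind asbool_and -mulnb natrM.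
have dA := depA (i := (i0 + m)%N).
rewrite (expect_indep _ _ (@ind_depends R _ _ _ _ dT) (@ind_depends R _ _ _ _ dA) disj) exprSr.
have E0 U (B : (site -> St) -> Prop) w : 0 <= E U (fun w => ind (B w)) w.
  by apply: expect_ge0 => [s||w']; [exact: uniform_law_ge0|exact: uniform_law_sum1|exact: ind_ge0].
exact: ler_pM.
Qed.

Variable rho : site -> site -> St -> St -> bool.
Hypothesis rho_sym : forall x y s t, rho x y s t = rho y x t s.
Hypothesis infinite_events : forall w, has_infinite_component (@open_set R k rho w) ->
  exists i0, forall i, (i0 <= i)%N -> A i w.

(** For each [i0], the event that all [A i] with i >= i0 occur has probability at most (1 - eps)^m
    for every m, hence zero; countably many such events cover the infinite components. *)
Lemma model_not_percolates : ~ percolates (@model R k rho rho_sym).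
Proof.
pose B i0 : set R := [set u | forall i, (i0 <= i)%N -> A i (config k u)].
have mA i : measurable [set u : R | A i (config k u)].
  by have [] := prob_config R (fun=> ord0) (uniqS i) (depA (i := i)).
have mB i0 : measurable (B i0).
  rewrite (_ : B i0 = \bigcap_i (if (i0 <= i)%N then [set u | A i (config k u)] else setT)).
    by apply: bigcapT_measurable => i; case: ifP.
  apply/seteqP; split => u H i; first by move=> _; case: ifP => // /H.
  by move=> i0i; have := H i I; rewrite i0i.
have PB i0 : P (B i0) = 0%E.
  apply/eqP; rewrite eq_le measure_ge0 andbT; apply/lee_addgt0Pr => e e0.
  rewrite add0e.
  have /andP[eps0 eps1] := eps01.
  have [m me] : exists m, (1 - eps) ^+ m <= e.
    have z1 : `|1 - eps| < 1 by rewrite ger0_norm; lra.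
    have [m _ mP] := cvgr0_norm_lt _ (cvg_expr z1) _ e0.
    exists m; apply: le_trans (ler_norm _) (ltW _); exact: (mP m (leqnn m)).
  have [T [uT _ dT ET]] := expect_all_le i0 m.
  have [mT PT] := prob_config R (fun=> ord0) uT dT.
  apply: (@le_trans _ _ (P [set u | forall i, (i0 <= i < i0 + m)%N -> A i (config k u)])).
    apply: le_measure; [by rewrite inE; exact: mB|by rewrite inE|].
    by move=> u H i /andP[i0i _]; exact: H.
  by rewrite PT lee_fin (le_trans ET).
rewrite /percolates; apply/negP; rewrite -leNgt.
have mI : measurable (random_subgraph rho @^-1` @has_infinite_component G).
  have := @measurable_random_subgraph R k rho rho_sym measurableT _
    (measurable_has_infinite_component (G := G)).
  by rewrite setTI.
rewrite -[X in (X <= _)%E]/(P (random_subgraph rho @^-1` @has_infinite_component G)).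
apply: (@le_trans _ _ (P (\bigcup_i0 B i0))).
  apply: le_measure; [by rewrite inE|by rewrite inE; exact: bigcupT_measurable|].
  by move=> u /infinite_events[i0 H]; exists i0.
rewrite le_eqVlt; apply/orP; left; apply/eqP.
apply: measure_negligible; first exact: bigcupT_measurable.
by apply: negligible_bigcup => i; exists (B i); split; [exact: mB|exact: PB|].
Qed.

End NonPercolation.

(** * Leaf models *)

Section Annuli.
Variables (n N : nat -> nat).
Hypothesis nN : forall k, (n k < N k)%N.
Hypothesis nS : forall k, n k.+1 = (2 * N k).+1.

Lemma annuli_ge k : (k <= n k)%N.
Proof. by elim: k => // k IH; rewrite nS; move: (nN k) IH; clear; lia. Qed.

Lemma annuli_lt j k : (j < k)%N -> (N j < n k)%N.
Proof.
elim: k => // k IH; rewrite ltnS leq_eqVlt nS => /orP[/eqP ->|/IH h].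
  by clear; lia.
by move: (nN k) h; clear; lia.
Qed.

Lemma annuli_disjoint i j v : annulus (n i) (N i) v -> annulus (n j) (N j) v -> i = j.
Proof.
move=> /andP[a1 a2] /andP[b1 b2]; have [ij|ji|//] := ltngtP i j; exfalso.
  by move: (annuli_lt ij) a1 b2; rewrite /in_box; clear; lia.
by move: (annuli_lt ji) b1 a2; rewrite /in_box; clear; lia.
Qed.

End Annuli.

(** The next inner radius is [2 * N + 1] to make room for a diamond: where |x| + |y| = 2 N + 1, a
    site is outside the box of radius N but inside that of radius 2 N + 1. *)
Lemma blockable_annuli (R : archiRealFieldType) e (q : R) : blockable e q ->
  exists eps (n N : nat -> nat), [/\ 0 < eps, forall k, (n k < N k)%N,
    forall k, n k.+1 = (2 * N k).+1 &
    forall k, eps <= prob q (N k) (fun w => ind (~ crossing (n k) (N k) e w))].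
Proof.
move=> [eps eps0 H].
have /choice[f fP] : forall n, exists N, (n < N)%N /\
    eps <= prob q N (fun w => ind (~ crossing n N e w)).
  by move=> n; have [N ? ?] := H n; exists N.
pose n k := iter k (fun m => (2 * f m).+1) 0%N.
exists eps, n, (f \o n); split => // k; by have [] := fP (n k).
Qed.

Section BlockedModel.
Variables (R : realType) (k : nat).
Local Notation St := 'I_k.+1.
Variables (e : rel site) (q eps : R) (n N : nat -> nat) (h : St -> bool) (emb : site -> site).
Hypothesis q01 : 0 <= q <= 1.
Hypothesis eps0 : 0 < eps.
Hypothesis nN : forall k, (n k < N k)%N.
Hypothesis nS : forall k, n k.+1 = (2 * N k).+1.
Hypothesis blocked : forall k, eps <= prob q (N k) (fun w => ind (~ crossing (n k) (N k) e w)).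
Hypothesis coinE : forall b, coin q b = \sum_(s | h s == b) @uniform_law R k s.
Hypothesis emb_inj : injective emb.
Variable rho : site -> site -> St -> St -> bool.
Hypothesis rho_sym : forall x y s t, rho x y s t = rho y x t s.
Hypothesis crossings : forall w, has_infinite_component (@open_set R k rho w) ->
  exists i0, forall i, (i0 <= i)%N -> crossing (n i) (N i) e (h \o w \o emb).

(** Common to both models: [h] reads the colour off a label, and [emb] places the coloured lattice
    among the sites, as the identity for the diamonds and as the rotated even sublattice for the
    parity model. *)
Lemma blocked_not_percolates : ~ percolates (@model R k rho rho_sym).
Proof.
pose S0 i := [seq v <- box_seq (N i) | annulus (n i) (N i) v].
pose C i (w : site -> bool) := crossing (n i) (N i) e w.
have uS0 i : uniq (S0 i) by apply/filter_uniq/box_seq_uniq.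
have dC i : depends_on (S0 i) (C i) by exact: arm_depends.
have EC i : expect (coin q) (S0 i) (fun w => ind (C i w)) xpred0 <= 1 - eps.
  have -> : expect (coin q) (S0 i) (fun w => ind (C i w)) xpred0 =
      prob q (N i) (fun w => ind (C i w)).
    rewrite /prob; apply/esym/expect_sub => //; [exact: coin_sum1|exact: box_seq_uniq| |].
      by move=> v; rewrite mem_filter => /andP[].
    exact: ind_depends.
  have := blocked i; rewrite /prob.
  under expect_ext do rewrite indN -[1 - _]/(1 + - _).
  by rewrite expect_add expect_opp (expect_cst (coin_sum1 q)) /C; lra.
apply: (@model_not_percolates R k (fun i => map emb (S0 i))
  (fun i w => C i (h \o w \o emb)) eps) => //.
- by move=> i; rewrite map_inj_uniq.
- move=> i j v /mapP[u ui ->] /mapP[u' + /emb_inj uu']; rewrite -uu'.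
  move: ui; rewrite !mem_filter => /andP[ui _] /andP[uj _].
  exact: annuli_disjoint ui uj.
- by move=> i w w' ww'; apply: dC => v vS /=; congr h; apply: ww'; exact: map_f.
- rewrite eps0 /=; apply: le_trans (blocked 0%N) _.
  rewrite -[leRHS](expect_cst (coin_sum1 q) (box_seq (N 0%N)) 1 xpred0).
  by apply: expect_le; [exact: coin_ge0|move=> w; exact: ind_le1].
move=> i; apply: le_trans (EC i).
rewrite (expect_map _ (S0 i) (fun w => ind (C i (h \o w)) : R) _ emb_inj).
rewrite (expect_push (law' := coin q) (S0 i) (fun w => ind (C i w) : R)) //.
rewrite le_eqVlt; apply/orP; left; apply/eqP.
apply: (@eq_expect _ _ _ _ (S0 i) (S0 i)); first exact: ind_depends.
by move=> v ->.
Qed.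

End BlockedModel.

Section LeafModel.
Variables (St : Type) (sol : site -> St -> bool) (target : site -> St -> site).

Definition leaf_rho (x y : site) (s t : St) : bool :=
  [|| sol x s && sol y t, ~~ sol x s && (y == target x s) | ~~ sol y t && (x == target y t)].

Lemma leaf_rho_sym x y s t : leaf_rho x y s t = leaf_rho y x t s.
Proof. by rewrite /leaf_rho [sol x s && _]andbC; congr orb; rewrite orbC. Qed.

Variable w : site -> St.
Local Notation solid := (fun v => sol v (w v)).

Definition leaf_open : rel site := fun u v => nn u v && leaf_rho u v (w u) (w v).

(* The path can leave the leaf y only towards a leaf that has chosen y. *)
Lemma leaf_trap x y p : uniq (x :: y :: p) -> ~~ solid y -> x = target y (w y) ->
  path leaf_open y p -> ~~ solid (last y p).
Proof.
elim: p x y => [//|z p IH] x y; rewrite cons_uniq => /andP[xyp uyp] nsy xE.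
rewrite [path _ _ _]/= => /andP[/andP[_ o] ep].
have xz : x != z by move: xyp; rewrite !notin_cons => /and3P[].
move: o; rewrite /leaf_rho (negbTE nsy) /= -xE eq_sym (negbTE xz) /= => /andP[nsz /eqP yE].
exact: (IH y z).
Qed.

(** If a solid site is followed by a leaf, this leaf has chosen the solid site; by [leaf_trap] the
    path then ends at a leaf. *)
Lemma leaf_solid_path x p : uniq (x :: p) -> solid x -> path leaf_open x p ->
  solid (last x p) -> all solid p.
Proof.
elim: p x => [//|y p IH] x uxp sx /= /andP[/andP[_ o] ep] sl.
have uyp : uniq (y :: p) by move: uxp; rewrite cons_uniq => /andP[].
have [sy|nsy] := boolP (solid y); first (apply/andP; split => //; exact: (IH y)).
move: o; rewrite /leaf_rho (negbTE nsy) sx /= => /eqP xE.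
by have := leaf_trap uxp nsy xE ep; rewrite sl.
Qed.

End LeafModel.

Section Paths.
Variables (e : rel site).

(** Stop at the first site outside the box of radius [N - 1], which is on the rim because a step
    moves each coordinate by at most one; then start after the last visit to the inner box. *)
Lemma crossing_of_path n N w x p : subrel e star -> (n < N)%N -> path e x p ->
  in_box n x -> ~~ in_box N.-1 (last x p) ->
  all (fun v => annulus n N v ==> w v) p -> crossing n N e w.
Proof.
move=> es nN ep bx bl wp.
have bxN : in_box N.-1 x by move: bx nN; rewrite /in_box; clear; lia.
have [p1 [y [p2 [E bp1 nby]]]] := first_exit bxN bl.
move: ep wp; rewrite E -cat_rcons cat_path all_cat => /andP[ep _] /andP[wp _].
have rim_y : rim N y.
  move: ep; rewrite rcons_path => /andP[_ /es].
  have /(allP bp1) : last x p1 \in x :: p1 by rewrite mem_last.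
  move: nby nN; case: (last x p1) (y) => a b [c d]; rewrite /rim /in_box /star /= xpair_eqE.
  by clear; lia.
have hx : has (in_box n) (x :: rcons p1 y) by rewrite /= bx.
have [q1 [x' [q' [E' bx' aq']]]] := last_exit hx.
have lE : last x' q' = y by rewrite -(last_rcons x p1 y) -(last_cons x) E' last_cat last_cons.
exists x', q'; split => //; last by rewrite lE.
  case: q1 E' => [[<- <-] //|z q1 [_ E']].
  by move: ep; rewrite E' cat_path /= => /and3P[].
have sub : {subset q' <= rcons p1 y}.
  case: q1 E' => [[_ ->] //|z q1 [_ ->]] v vq.
  by rewrite mem_cat in_cons vq !orbT.
apply/allP => v vq.
have av : annulus n N v.
  rewrite /annulus; apply/andP; split; last exact: (allP aq').
  have := sub _ vq; rewrite mem_rcons in_cons => /orP[/eqP ->|vp1].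
    by move: rim_y => /andP[].
  have : in_box N.-1 v by apply: (allP bp1); rewrite in_cons vp1 orbT.
  by rewrite /in_box; clear; lia.
by rewrite av; have := allP wp _ (sub _ vq); rewrite av.
Qed.

End Paths.

Lemma Z2_adj_nn (R : realType) : Z2_adj R =2 nn.
Proof.
case=> a b [c d]; rewrite /Z2_adj /euclidean_dist /=.
have sq (z : int) : (z = 0 \/ z = 1 \/ z = -1) \/ 4 <= z ^+ 2.
  have [|] := leP (`|z|) 1; first by clear; lia.
  by rewrite expr2 => h; right; nia.
rewrite -[X in _ == X](sqrtr1 R) eqr_sqrt ?ler01 ?addr_ge0 ?sqr_ge0 //.
rewrite -!rmorphB -!rmorphXn -rmorphD /= -[X in _ == X]/(1%:~R) eqr_int /nn /=.
have h0 (z : int) : 0 <= z ^+ 2 by exact: sqr_ge0.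
have [[e1|[e1|e1]]|h1] := sq (a - c); have [[e2|[e2|e2]]|h2] := sq (b - d);
  try first [by rewrite e1 e2; move: e1 e2; clear; lia | by rewrite e1; move: e1 h2; clear; lia
    | by rewrite e2; move: e2 h1; clear; lia].
have := h0 (a - c); move: h1 h2; clear; nia.
Qed.

Section Components.
Variables (R : realType) (k : nat).
Local Notation St := 'I_k.+1.
Variables (sol : site -> St -> bool) (target : site -> St -> site).

Lemma infinite_component_paths w :
  has_infinite_component (@open_set R k (leaf_rho sol target) w) ->
  exists x, forall M, exists p, [/\ path (leaf_open sol target w) x p, uniq (x :: p) &
    ~~ in_box M (last x p)].
Proof.
move=> [x infx]; exists x => M.
have [y [p [ep lp]] yM] : exists2 y, component (@open_set R k (leaf_rho sol target) w) x y &
    ~~ in_box M y.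
  apply: contrapT => H; apply: infx; apply: sub_finite_set (finite_seq (box_seq M)) => y Cy /=.
  by rewrite mem_box_seq; apply: contrapT => /negP ny; apply: H; exists y.
have ep' : path (leaf_open sol target w) x p.
  apply: sub_path ep => u v /asboolP[e [we euv]].
  have [u' [v' [uv' ee r]]] := we.
  have [|] := pair_set_eq (etrans (esym euv) ee) => -[-> ->]; apply/andP; split => //.
  - by rewrite -(Z2_adj_nn R).
  - by rewrite nn_sym -(Z2_adj_nn R).
  - by rewrite leaf_rho_sym.
move: lp; case/shortenP: ep' => p' ep' up' _ lp.
by exists p'; split => //; rewrite lp.
Qed.

End Components.

Definition norm1 (v : site) : nat := (`|v.1| + `|v.2|)%N.

(** Discrete intermediate value theorem: a nearest-neighbour step changes the 1-norm by one. *)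
Lemma norm1_hit x p r : path nn x p -> (norm1 x <= r <= norm1 (last x p))%N ->
  exists p1 p2, p = p1 ++ p2 /\ norm1 (last x p1) = r.
Proof.
elim: p x => [|y p IH] x /=; first by move=> _ xr; exists [::], [::]; split => //=; lia.
move=> /andP[xy ep] /andP[xr rl].
have [xr'|xr'] := eqVneq (norm1 x) r; first by exists [::], (y :: p).
have yr : (norm1 y <= r)%N.
  by move: xr xr' (nnP xy); case: (x) => a b; rewrite /norm1 /= => h1 h2 []-> /=; move: h1 h2; clear; lia.
have [|p1 [p2 [-> E]]] := IH y ep; first by rewrite yr.
by exists (y :: p1), p2.
Qed.

Section DiamondModel.
Variables (k : nat) (h : 'I_k.+1 -> bool) (target : site -> 'I_k.+1 -> site) (n N : nat -> nat).
Hypothesis nN : forall k, (n k < N k)%N.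
Hypothesis nS : forall k, n k.+1 = (2 * N k).+1.

Definition diamond : pred site := fun v => `[< exists k, norm1 v = n k.+1 >].

Definition diamond_solid (v : site) (s : 'I_k.+1) := h s || diamond v.

(** In the box of radius N j the 1-norm is at most 2 N j, less than the radius of the next diamond;
    outside the box of radius n i it exceeds n i, and so the radius of every diamond up to that
    one. *)
Lemma annulus_diamond i v : annulus (n i) (N i) v -> ~~ diamond v.
Proof.
move=> av; apply/asboolP => -[j jE].
have [ij|ij] := leqP i j.
  have : (N i <= N j)%N.
    move: ij; rewrite leq_eqVlt => /orP[/eqP ->//|/(annuli_lt nN nS) lt].
    by move: (nN j) lt; clear; lia.
  by move: jE av; rewrite /annulus /in_box /norm1 nS; clear; lia.
have : (n j.+1 <= n i)%N.
  move: ij; rewrite leq_eqVlt => /orP[/eqP ->//|/(annuli_lt nN nS) lt].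
  by move: (nN j.+1) lt; clear; lia.
by move: jE av; rewrite /annulus /in_box /norm1; clear; lia.
Qed.

(** A simple path that goes far enough visits two consecutive diamonds. Between them it is solid,
    and it passes through the annulus that they enclose, where solid means black. *)
Lemma diamond_model_crossings (R : realType) w :
  has_infinite_component (@open_set R k (leaf_rho diamond_solid target) w) ->
  exists i0, forall i, (i0 <= i)%N -> crossing (n i) (N i) nn (h \o w \o id).
Proof.
move=> /infinite_component_paths[x xP]; exists (norm1 x).+1 => -[//|i]; rewrite ltnS => xi.
have [p [ep up lp]] := xP (n i.+2).
have xn : (norm1 x <= n i.+1)%N.
  by have := annuli_ge nN nS i.+1; move: xi; clear; lia.
have nn2 : (n i.+1 <= n i.+2)%N by move: (nN i.+1); rewrite [n i.+2]nS; clear; lia.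
have ln : (n i.+2 <= norm1 (last x p))%N by move: lp; rewrite /in_box /norm1; clear; lia.
have open_nn : subrel (leaf_open diamond_solid target w) nn by move=> u v /andP[].
have [|p1 [p2 [E y_r]]] := norm1_hit (sub_path open_nn ep) (r := n i.+1).
  by rewrite xn (leq_trans nn2).
move: ep up lp ln; rewrite E cat_path last_cat => /andP[_ ep2] up _ ln.
set y := last x p1 in y_r ep2 ln.
have uy : uniq (y :: p2).
  by move: up; rewrite -cat_cons lastI cat_rcons cat_uniq => /and3P[].
have [|p3 [p4 [E2 z_r]]] := norm1_hit (sub_path open_nn ep2) (r := n i.+2).
  by rewrite y_r nn2.
move: ep2 uy; rewrite E2 cat_path -cat_cons cat_uniq => /andP[ep3 _] /and3P[uy _ _].
have sy : diamond_solid y (w y) by apply/orP; right; apply/asboolP; exists i.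
have sz : diamond_solid (last y p3) (w (last y p3)).
  by apply/orP; right; apply/asboolP; exists i.+1.
have sp := leaf_solid_path uy sy ep3 sz.
apply: (crossing_of_path (x := y) (p := p3)) => //.
- exact: nn_star.
- exact: sub_path ep3.
- by move: y_r; rewrite /norm1 /in_box; clear; lia.
- by move: z_r; rewrite nS /norm1 /in_box; move: (N i.+1); clear; lia.
apply: sub_all sp => v /= sv; apply/implyP => /annulus_diamond nd.
by move: sv; rewrite /diamond_solid (negbTE nd) orbF.
Qed.

End DiamondModel.

Definition odd_site : pred site := fun v => odd `|(v.1 + v.2)%R|.

(* Rotates and scales Z^2 onto the even sublattice: even sites with a common neighbour
   correspond to star-adjacent sites. *)
Definition even_site (v : site) : site := (v.1 + v.2, v.1 - v.2).

Lemma even_site_inj : injective even_site.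
Proof. by move=> [a b] [c d] [] e1 e2; congr pair; move: e1 e2; clear; lia. Qed.

Lemma odd_even_site v : odd_site (even_site v) = false.
Proof. by case: v => a b; rewrite /odd_site /=; clear; lia. Qed.

Lemma even_siteP v : ~~ odd_site v -> exists a, even_site a = v.
Proof.
case: v => a b; rewrite /odd_site /= => h.
exists (((a + b) %/ 2)%Z, ((a - b) %/ 2)%Z); rewrite /even_site /=.
by congr pair; move: h; clear; lia.
Qed.

Lemma nn_odd_site u v : nn u v -> odd_site v = ~~ odd_site u.
Proof. by move=> /nnP; case: u v => a b [c d] []->; rewrite /odd_site /=; clear; lia. Qed.

Lemma even_site_star a b z : nn (even_site a) z -> nn z (even_site b) -> a != b -> star a b.
Proof.
move=> /nnP az /nnP zb ab; rewrite /star ab /=.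
have : (`|((even_site a).1 - (even_site b).1)%R| + `|((even_site a).2 - (even_site b).2)%R| <= 2)%N.
  by case: az zb => -> [] ->; rewrite /= /even_site /=; clear; lia.
by case: a b {az zb ab} => a1 a2 [b1 b2]; rewrite /even_site /=; clear; lia.
Qed.

(** Every second site is even, and consecutive even sites share an odd neighbour. They are distinct,
    as [star] demands, because the path is simple. *)
Lemma even_star_path x p : odd_site x -> path nn x p -> uniq (x :: p) -> odd_site (last x p) ->
  p != [::] -> exists a q, [/\ even_site a = head x p, path star a q,
    all (fun b => even_site b \in p) (a :: q) & nn (even_site (last a q)) (last x p)].
Proof.
have [m] := ubnP (size p); elim: m x p => // m IH x [//|y [|z p]] pm ox.
  by rewrite [path _ _ _]/= andbT => /nn_odd_site; rewrite /= ox => ->.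
rewrite [path _ _ _]/= => /and3P[xy yz ep] uxp ol _.
have ey : ~~ odd_site y by rewrite (nn_odd_site xy) ox.
have oz : odd_site z by rewrite (nn_odd_site yz) ey.
have [a aE] := even_siteP ey.
have [p0|p0] := eqVneq p [::].
  by exists a, [::]; subst p; rewrite /= aE in_cons eqxx.
have uzp : uniq (z :: p) by move: uxp; rewrite 2!cons_uniq => /and3P[].
have [|b [q [bE bq qp lq]]] := IH z p _ oz ep uzp ol p0.
  by move: pm => /=; clear; lia.
exists a, (b :: q); split => //.
- rewrite /= bq andbT; apply: (@even_site_star a b z); first by rewrite aE.
    by rewrite bE; case: p p0 ep {uzp IH pm uxp ol lq qp bE} => //= ? ? _ /andP[].
  apply: contraTneq uxp => ab; rewrite 2!cons_uniq negb_and; apply/orP; right.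
  rewrite negb_and; apply/orP; left; rewrite negbK in_cons; apply/orP; right.
  by rewrite -aE ab; case/andP: qp.
apply/andP; split; first by rewrite aE mem_head.
by apply: sub_all qp => c cp; rewrite !in_cons cp !orbT.
Qed.

Section ParityModel.
Variables (k : nat) (h : 'I_k.+1 -> bool) (target : site -> 'I_k.+1 -> site) (n N : nat -> nat).
Hypothesis nN : forall k, (n k < N k)%N.
Hypothesis nS : forall k, n k.+1 = (2 * N k).+1.

Definition parity_solid (v : site) (s : 'I_k.+1) := odd_site v || h s.

Lemma in_box_step m u v : nn u v -> in_box m u -> in_box m.+1 v.
Proof. by move=> /nnP; case: u v => a b [c d] []->; rewrite /in_box /=; clear; lia. Qed.

Lemma parity_model_crossings (R : realType) w :
  has_infinite_component (@open_set R k (leaf_rho parity_solid target) w) ->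
  exists i0, forall i, (i0 <= i)%N -> crossing (n i) (N i) star (h \o w \o even_site).
Proof.
move=> /infinite_component_paths[x xP]; exists (norm1 x).+2 => i xi.
have open_nn : subrel (leaf_open parity_solid target w) nn by move=> u v /andP[].
have {}xi : ((norm1 x).+2 <= n i)%N by exact: leq_trans (annuli_ge nN nS i).
(* The rotation maps the box of radius N into that of radius 2 N. The margin allows for dropping a
   last even site and for the step from the last even site of the remaining path to its odd end. *)
pose M := (2 * N i).+3.
have xM : in_box M x by move: xi (nN i); rewrite /in_box /norm1 /M; clear; lia.
have [p [ep up lp]] := xP M.
have [x1 [p1 [ox1 bx1 ep1 up1 lp1]]] : exists x1 p1, [/\ odd_site x1, in_box (norm1 x).+1 x1,
    path (leaf_open parity_solid target w) x1 p1, uniq (x1 :: p1) & ~~ in_box M (last x1 p1)].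
  have [ox|ex] := boolP (odd_site x).
    by exists x, p; split => //; rewrite /in_box /norm1; clear; lia.
  case: p ep up lp => [|y p]; first by rewrite /= xM.
  rewrite [path _ _ _]/= cons_uniq => /andP[xy ep] /andP[_ up] lp.
  exists y, p; split => //; first by rewrite (nn_odd_site (open_nn _ _ xy)).
  by apply: in_box_step (open_nn _ _ xy) _; rewrite /in_box /norm1; clear; lia.
have [p2 [ep2 up2 ol2 lp2]] : exists p2, [/\ path (leaf_open parity_solid target w) x1 p2,
    uniq (x1 :: p2), odd_site (last x1 p2) & ~~ in_box M.-1 (last x1 p2)].
  have [ol|el] := boolP (odd_site (last x1 p1)).
    by exists p1; split => //; move: lp1; rewrite /in_box; clear; lia.
  case/lastP: p1 ep1 up1 lp1 el => [|p1 z]; first by rewrite /= ox1.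
  rewrite rcons_path last_rcons -rcons_cons rcons_uniq => /andP[ep1 z1] /andP[_ up1] lz ez.
  have nz := open_nn _ _ z1.
  exists p1; split => //; first by move: ez; rewrite (nn_odd_site nz) negbK.
  by apply: contra lz => /(in_box_step nz).
have sp : all (fun v => parity_solid v (w v)) p2.
  by apply: leaf_solid_path up2 _ ep2 _; rewrite /parity_solid ?ox1 ?ol2.
have p20 : p2 != [::].
  apply: contraNneq lp2 => -> /=; move: bx1 xi (nN i).
  by rewrite /in_box /norm1 /M; clear; lia.
have nx1 : nn x1 (head x1 p2).
  by case: p2 p20 ep2 {up2 ol2 lp2 sp} => //= y p2 _ /andP[/open_nn].
have [a [q [aE eq qp lq]]] := even_star_path ox1 (sub_path open_nn ep2) up2 ol2 p20.
apply: (crossing_of_path (x := a) (p := q)) => //.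
- have := in_box_step nx1 bx1; rewrite -aE; move: xi.
  by rewrite /in_box /even_site /=; clear; lia.
- apply: contra lp2 => b; apply: (in_box_step lq).
  by move: b; rewrite /in_box /even_site /=; clear; lia.
apply: sub_all (andP qp).2 => b bp /=; apply/implyP => _.
by have := allP sp _ bp; rewrite /parity_solid odd_even_site.
Qed.

End ParityModel.

(** * Edge probabilities *)

Section EdgeProbabilities.
Variables (R : realType) (k a m : nat).
Hypothesis kE : k.+1 = (m * 4)%N.
Hypothesis am : (a <= m)%N.
Local Notation St := 'I_k.+1.
Local Notation q := (a%:R / m%:R : R).

Definition mean (f : St -> R) := \sum_s uniform_law R s * f s.

Lemma mean_cst c : mean (fun=> c) = c.
Proof. by rewrite /mean -mulr_suml uniform_law_sum1 mul1r. Qed.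

Lemma meanD f g : mean (fun s => f s + g s) = mean f + mean g.
Proof. by rewrite /mean -big_split; apply: eq_bigr => s _; rewrite mulrDr. Qed.

Lemma meanZ c f : mean (fun s => c * f s) = c * mean f.
Proof. by rewrite /mean mulr_sumr; apply: eq_bigr => s _; rewrite mulrCA. Qed.

Lemma mean_ext f g : f =1 g -> mean f = mean g.
Proof. by move=> fg; apply: eq_bigr => s _; rewrite fg. Qed.

Lemma m_gt0 : (0 < m)%N.
Proof. by case: m kE. Qed.

(** Quotient and remainder by 4 of a uniform label are independent and uniform; this makes the
    colour of a site independent of its choice as a leaf. *)
Lemma mean_divmod (f g : nat -> R) : mean (fun s => f (s %/ 4)%N * g (s %% 4)%N) =
  (m%:R^-1 * \sum_(j < m) f j) * (4^-1 * \sum_(i < 4) g i).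
Proof.
rewrite /mean /uniform_law -(big_mkord xpredT (fun s => k.+1%:R^-1 * (f (s %/ 4)%N * g (s %% 4)%N))).
rewrite kE big_nat_mul mulrACA mulr_suml mulr_sumr big_mkord; apply: eq_bigr => j _.
rewrite -[X in \sum_(X <= _ < _) _]add0n big_addn mulSn addnK big_mkord !mulr_sumr.
apply: eq_bigr => i _; rewrite [(i + _)%N]addnC divnMDl // modnMDl divn_small // modn_small // addn0.
by rewrite natrM invfM.
Qed.

Lemma sum_lt : \sum_(j < m) (j < a)%N%:R = a%:R :> R.
Proof.
rewrite -natr_sum; congr _%:R.
rewrite -[RHS]card_ord -sum1_card (big_ord_widen m (fun=> 1%N) am) [RHS]big_mkcond.
by apply: eq_bigr => j _; case: (_ < _)%N.
Qed.

Definition black (s : St) : bool := (s %/ 4 < a)%N.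

Lemma mean_black_digit (D : pred nat) :
  mean (fun s => (black s && D (s %% 4)%N)%:R) = q * (4^-1 * \sum_(i < 4) (D i)%:R).
Proof.
rewrite [q]mulrC -sum_lt -(mean_divmod (fun j => (j < a)%N%:R) (fun i => (D i)%:R)).
by apply: mean_ext => s; rewrite -natrM mulnb.
Qed.

Lemma mean_black : mean (fun s => (black s)%:R) = q.
Proof.
transitivity (mean (fun s => (black s && xpredT (s %% 4)%N)%:R)).
  by apply: mean_ext => s; rewrite andbT.
by rewrite (mean_black_digit xpredT) !big_ord_recl big_ord0 /=; field; rewrite pnatr_eq0 -lt0n m_gt0.
Qed.

Lemma mean_white_digit (D : pred nat) :
  mean (fun s => (~~ black s && D (s %% 4)%N)%:R) = (1 - q) * (4^-1 * \sum_(i < 4) (D i)%:R).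
Proof.
have ED : mean (fun s => (D (s %% 4)%N)%:R) = 4^-1 * \sum_(i < 4) (D i)%:R.
  transitivity (mean (fun s => 1 * (D (s %% 4)%N)%:R)).
    by apply: mean_ext => s; rewrite mul1r.
  rewrite (mean_divmod (fun=> 1) (fun i => (D i)%:R)) sumr_const card_ord -[1 *+ m]/(m%:R).
  by rewrite mulVf ?mul1r // pnatr_eq0 -lt0n m_gt0.
rewrite mulrBl mul1r -mean_black_digit -ED; apply/eqP.
rewrite eq_sym subr_eq -meanD; apply/eqP/mean_ext => s.
by rewrite -natrD; case: black; case: (D _).
Qed.

Lemma mean_white : mean (fun s => (~~ black s)%:R) = 1 - q.
Proof.
rewrite -mean_black -[X in X - _](mean_cst 1); apply/eqP; rewrite eq_sym subr_eq -meanD.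
by apply/eqP/mean_ext => s; rewrite -natrD; case: black.
Qed.

Lemma coin_mean (h : St -> bool) p b : mean (fun s => (h s)%:R) = p ->
  coin p b = \sum_(s | h s == b) uniform_law R s.
Proof.
move=> <-; rewrite big_mkcond /=; case: b.
  by apply: eq_bigr => s _; case: (h s); rewrite ?mulr1 ?mulr0.
rewrite /= -[X in X - _](mean_cst 1); apply/eqP; rewrite subr_eq -big_split /=.
by apply/eqP; apply: eq_bigr => s _; case: (h s); rewrite ?mulr1 ?mulr0 ?addr0 ?add0r.
Qed.

Lemma model_is_open_ge (rho : site -> site -> St -> St -> bool) rho_sym (e : edge (Z2 R))
    (x y : site) (F : St -> St -> R) :
  nn x y -> sval e = [set x; y] -> (forall s t, F s t <= (rho x y s t)%:R) ->
  ((mean (fun s => mean (F s)))%:E <= @model R k rho rho_sym (is_open e))%E.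
Proof.
move=> xy ee Fr; rewrite -(Z2_adj_nn R) in xy.
rewrite (model_is_open rho_sym xy ee) lee_fin; apply: ler_sum => s _.
rewrite mulr_sumr; apply: ler_sum => t _.
rewrite mulrA -exprVn expr2 ler_wpM2l //.
by rewrite mulr_ge0 // invr_ge0.
Qed.

Lemma edge_nn (e : edge (Z2 R)) : exists x y, nn x y /\ sval e = [set x; y].
Proof. by have [x [y [xy ee _]]] := edge_ends e; exists x, y; rewrite -(Z2_adj_nn R). Qed.

Definition neighbour (v : site) (s : St) : site :=
  nth v [:: (v.1, v.2 + 1); (v.1, v.2 - 1); (v.1 + 1, v.2); (v.1 - 1, v.2)] (s %% 4).

Lemma neighbourP x y : nn x y -> exists2 d, (d < 4)%N &
  forall s : St, (s %% 4)%N = d -> y = neighbour x s.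
Proof.
move=> /nnP[]->; [exists 0%N|exists 1%N|exists 2%N|exists 3%N] => // s;
  by rewrite /neighbour => ->.
Qed.

(** Take the even end first. The edge is open if this end is white, or if it is black and has chosen
    the odd end: (1 - q) + q/4. *)
Lemma parity_model_is_open rho_sym (e : edge (Z2 R)) :
  ((1 - 3 / 4 * q)%:E <= @model R k (leaf_rho (parity_solid (negb \o black)) neighbour) rho_sym
    (is_open e))%E.
Proof.
have [x [y [xy ee ox]]] : exists x y, [/\ nn x y, sval e = [set x; y] & ~~ odd_site x].
  have [x [y [xy ee]]] := edge_nn e.
  have [ox|ex] := boolP (odd_site x); last by exists x, y.
  by exists y, x; rewrite nn_sym xy setUC ee (nn_odd_site xy) ox.
have oy : odd_site y by rewrite (nn_odd_site xy).
have [d d4 dP] := neighbourP xy.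
pose F (s t : St) : R := (~~ black s)%:R + (black s && ((s %% 4)%N == d))%:R.
apply: le_trans (model_is_open_ge rho_sym (F := F) xy ee _); last first.
  move=> s t; rewrite /F /leaf_rho /parity_solid oy (negbTE ox) /= andbT.
  case: black; last by rewrite addr0.
  by case: eqP => [/dP <-|_]; rewrite add0r ?eqxx ?ler0n.
rewrite /F; under mean_ext do rewrite mean_cst.
rewrite meanD mean_white (mean_black_digit (fun i => i == d)) lee_fin.
have -> : \sum_(i < 4) ((i : nat) == d)%:R = 1 :> R.
  by move: d4 {dP F}; case: d => [|[|[|[|//]]]] _; rewrite !big_ord_recl big_ord0 /= ?add0r ?addr0.
by lra.
Qed.

Definition up_right (v : site) (s : St) : site :=
  if (s %% 4 < 2)%N then (v.1 + 1, v.2) else (v.1, v.2 + 1).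

(** Off the diamonds, both ends are black or the left or lower end is white and has chosen the
    other, as only that end can. If one end is on a diamond, it suffices that the other is black. *)
Lemma diamond_model_is_open n (p : R) rho_sym (e : edge (Z2 R)) :
  p <= q -> p <= q ^+ 2 + (1 - q) / 2 ->
  (p%:E <= @model R k (leaf_rho (diamond_solid black n) up_right) rho_sym (is_open e))%E.
Proof.
move=> pq pq2.
have [x [y [xy ee yE]]] : exists x y, [/\ nn x y, sval e = [set x; y] &
    y = (x.1 + 1, x.2) \/ y = (x.1, x.2 + 1)].
  have [x [y [xy ee]]] := edge_nn e.
  have [E|E|E|E] := nnP xy; first by exists x, y; split; auto.
  - exists y, x; rewrite nn_sym xy setUC ee; split => //; right; rewrite E /= subrK.
    exact: surjective_pairing.
  - by exists x, y; split; auto.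
  - exists y, x; rewrite nn_sym xy setUC ee; split => //; left; rewrite E /= subrK.
    exact: surjective_pairing.
have [dx|ndx] := boolP (diamond n x).
  apply: le_trans (model_is_open_ge rho_sym (F := fun s t => (black t)%:R) xy ee _); last first.
    move=> s t; rewrite /leaf_rho /diamond_solid dx orbT /=.
    by case: black => //=; rewrite ler01.
  by rewrite lee_fin mean_cst mean_black.
have [dy|ndy] := boolP (diamond n y).
  apply: le_trans (model_is_open_ge rho_sym (F := fun s t => (black s)%:R) xy ee _); last first.
    move=> s t; rewrite /leaf_rho /diamond_solid dy orbT /=.
    by case: black => //=; rewrite ler01.
  by under mean_ext do rewrite mean_cst; rewrite lee_fin mean_black.
pose D : pred nat := fun i => if y == (x.1 + 1, x.2) then (i < 2)%N else (2 <= i)%N.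
have DP (s : St) : D (s %% 4)%N -> y = up_right x s.
  rewrite /D /up_right; case: eqP => [-> ->//|ny]; rewrite leqNgt => /negbTE ->.
  by case: yE.
pose F (s t : St) : R := (black s)%:R * (black t)%:R + (~~ black s && D (s %% 4)%N)%:R.
apply: le_trans (model_is_open_ge rho_sym (F := F) xy ee _); last first.
  move=> s t; rewrite /F /leaf_rho /diamond_solid (negbTE ndx) (negbTE ndy) !orbF.
  case: black => /=; first by rewrite mul1r addr0 ler_nat; case: black.
  rewrite mul0r add0r; case: (boolP (D _)) => [/DP <-|//].
  by rewrite eqxx.
have -> : mean (fun s => mean (F s)) = q * q + (1 - q) * (4^-1 * \sum_(i < 4) (D i)%:R).
  transitivity (mean (fun s => q * (black s)%:R + (~~ black s && D (s %% 4)%N)%:R)).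
    apply: mean_ext => s; rewrite /F meanD mean_cst; congr (_ + _).
    by rewrite meanZ mean_black mulrC.
  by rewrite meanD meanZ mean_black mean_white_digit.
rewrite lee_fin; apply: le_trans pq2 _; rewrite /D !big_ord_recl big_ord0 /=.
by case: (y == _) => /=; rewrite expr2; lra.
Qed.

End EdgeProbabilities.

(** * The lower bound for [p_max] *)

Lemma p_max_ge (R : realType) p (mu : percolation_model R (Z2 R)) :
  D_ge p mu -> ~ percolates mu -> p <= p_max R (Z2 R).
Proof.
move=> Dp np; apply: ub_le_sup; last by exists mu.
exists 1 => p' [mu' [[_ /(_ _) H] _]].
have adj01 : @adj (Z2 R) (0, 0) (1, 0) by rewrite /= Z2_adj_nn.
pose e : edge (Z2 R) := exist _ [set (0, 0); (1, 0)] (ex_intro _ _ (ex_intro _ _ (conj adj01 erefl))).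
rewrite -lee_fin; apply: le_trans (H e) (probability_le1 _ _).
by apply: sub_sigma_algebra; exists e.
Qed.

Lemma p_max_ge_fraction (R : realType) (a m : nat) (p : R) : (0 < a < m)%N ->
  p <= a%:R / m%:R -> p <= (a%:R / m%:R) ^+ 2 + (1 - a%:R / m%:R) / 2 ->
  p <= 1 - 3 / 4 * (a%:R / m%:R) -> p <= p_max R (Z2 R).
Proof.
move=> /andP[a0 am] pq pq2 pq3; set q := a%:R / m%:R in pq pq2 pq3 *.
have kE : (m * 4).-1.+1 = (m * 4)%N by move: am; clear; lia.
have q01 : 0 < q < 1.
  have m0 : 0 < m%:R :> R by rewrite ltr0n (leq_ltn_trans _ am).
  apply/andP; split; first by rewrite /q divr_gt0 // ltr0n.
  by rewrite /q ltr_pdivrMr // mul1r ltr_nat.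
have q01' : 0 <= q <= 1 by case/andP: q01 => /ltW -> /ltW.
have [|] := blockable_dichotomy q01.
  move=> /blockable_annuli[eps [n [N [eps0 nN nS blocked]]]].
  pose k := (m * 4).-1.
  pose sol := diamond_solid (@black k a) n.
  have sym := leaf_rho_sym sol (@up_right k).
  apply: (@p_max_ge R p (model R sym)).
    split; first exact: model_one_independent.
    by move=> e; exact: (diamond_model_is_open (n := n) kE (ltnW am) sym e pq pq2).
  apply: (blocked_not_percolates q01' eps0 nN nS blocked (h := @black k a) (emb := id)) => //.
    by move=> b; apply: coin_mean; apply: mean_black => //; exact: ltnW.
  by move=> w; exact: diamond_model_crossings.
move=> /blockable_annuli[eps [n [N [eps0 nN nS blocked]]]].
pose k := (m * 4).-1.
pose sol := parity_solid (negb \o @black k a).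
have sym := leaf_rho_sym sol (@neighbour k).
apply: (@p_max_ge R p (model R sym)).
  split; first exact: model_one_independent.
  move=> e; apply: (le_trans _ (parity_model_is_open kE (ltnW am) sym e)).
  by rewrite lee_fin.
have q01'' : 0 <= 1 - q <= 1 by case/andP: q01' => *; apply/andP; split; lra.
apply: (blocked_not_percolates q01'' eps0 nN nS blocked (h := negb \o @black k a)
  (emb := even_site)) => //.
- by move=> b; apply: coin_mean; apply: mean_white => //; exact: ltnW.
- exact: even_site_inj.
- by move=> w; exact: parity_model_crossings.
Qed.

Lemma fraction_below (R : realType) (x d : R) : 0 <= x -> 0 < d ->
  exists a m : nat, [/\ (0 < m)%N, a%:R / m%:R <= x & x < a%:R / m%:R + d].
Proof.
move=> x0 d0; have di : 0 <= d^-1 by rewrite invr_ge0 ltW.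
pose m := (Num.truncn d^-1).+1; exists (Num.truncn (x * m%:R)), m.
have m0 : 0 < m%:R :> R by rewrite ltr0n.
have /andP[_ dm] := truncn_itv di.
have xm : 0 <= x * m%:R by rewrite mulr_ge0 // ltW.
have /andP[h1 h2] := truncn_itv xm.
split => //; first by rewrite ler_pdivrMr.
rewrite -ltrBlDr ltr_pdivlMr //; move: h2; rewrite -addn1 natrD mulrBl => h2.
have : 1 < m%:R * d by rewrite -ltr_pdivrMr // div1r.
by lra.
Qed.

Theorem theorem1p5 (R : realType) :
  (35 - 3 * Num.sqrt 33) / 32 <= p_max R (Z2 R) /\
  (555 + 197 / 1000) / 1000 <= (35 - 3 * Num.sqrt 33) / 32 :> R /\
  (35 - 3 * Num.sqrt 33) / 32 < (555 + 198 / 1000) / 1000 :> R.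
Proof.
set r := Num.sqrt 33.
have r0 : 0 <= r by exact: sqrtr_ge0.
have r2 : r ^+ 2 = 33 by rewrite sqr_sqrtr.
(* The fractions [3958 / 689] and [1057 / 184] enclose the square root of 33 closely enough for the
   six decimals claimed. *)
have lb : 3958 / 689 < r.
  by rewrite ltNge; apply/negP => h; have := ler_pM r0 r0 h h; rewrite -expr2 r2; lra.
have ub : r < 1057 / 184.
  have c0 : 0 <= 1057 / 184 :> R by lra.
  by rewrite ltNge; apply/negP => h; have := ler_pM c0 c0 h h; rewrite -[r * r]expr2 r2; lra.
split; last by split; lra.
rewrite leNgt; apply/negP => lt.
set x := (35 - 3 * r) / 32 in lt.
pose p := (p_max R (Z2 R) + x) / 2.
have px : p < x by rewrite /p; lra.
(* The bound [x - p] keeps both edge probabilities above [p]; the bound 1/2 keeps the approximation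
   of q0 positive. *)
pose d := Num.min (x - p) (1 / 2).
have d0 : 0 < d by rewrite /d lt_min; apply/andP; split; lra.
have d1 : d <= x - p by rewrite /d ge_min lexx.
have d2 : d <= 1 / 2 by rewrite /d ge_min lexx orbT.
have qs0 : 0 <= (r - 1) / 8 by lra.
have [a [m [m0 q1 q2]]] := fraction_below qs0 d0.
set q : R := a%:R / m%:R in q1 q2.
have mp : 0 < m%:R :> R by rewrite ltr0n.
have am : (0 < a < m)%N.
  have : 0 < q < 1 by apply/andP; split; lra.
  by rewrite /q pmulr_lgt0 ?invr_gt0 // ltr_pdivrMr // mul1r ltr0n ltr_nat.
have xE : x = ((r - 1) / 8) ^+ 2 + (1 - (r - 1) / 8) / 2.
  by rewrite /x; move: r2; clear; nra.
have : p <= p_max R (Z2 R).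
  apply: (p_max_ge_fraction am); rewrite -/q.
  - by move: px d1 q2; rewrite /x; lra.
  (* For f(q) = q^2 + (1 - q)/2, the difference f(q0) - f(q) is (q0 - q)(q0 + q - 1/2). The product
     shown nonnegative is q0 - q minus this difference, so [f] loses at most q0 - q < d. *)
  - have : ((r - 1) / 8 - q) * (3 / 2 - ((r - 1) / 8 + q)) >= 0 by apply: mulr_ge0; lra.
    by move: d1 q2; rewrite xE; lra.
  - by move: px q1; rewrite /x; lra.
by rewrite /p; lra.
Qed.
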